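(* Let $G$ be a tubular group. The following are equivalent: (1) $G$ is residually finite; (2) $G$ has a primitive domain; (3) $G$ has a primitive target; (4) $G$ is virtually primitive; (5) $G$ has separable edge groups, i.e. each edge group is a separable subgroup of $G$; (6) $G$ has a regulating $\mathcal{E}$-tuple.
   Context: Tubular groups. A finitely generated group $G$ is tubular if it splits as a graph of groups over a finite connected directed graph $\Gamma$ with every vertex group $G_v\cong\mathbb{Z}^2$ and every edge group $G_e\cong\mathbb{Z}$; a tubular group is considered together with such a splitting. $\mathcal{V}$ and $\mathcal{E}$ are the vertex and edge sets of $\Gamma$; $-e,+e$ are the initial and terminal vertices of $e\in\mathcal{E}$; $\varphi_e^{\pm}:G_e\to G_{\pm e}$ are the (injective) attaching maps. Vertex and edge groups are written additively. Primitivity. A tubular group is primitive if for every edge $e$ each of $\varphi_e^{+}(G_e)$, $\varphi_e^{-}(G_e)$ is a maximal cyclic subgroup of its vertex group. A nontrivial element of a finitely generated free abelian group $A$ is primitive in $A$ if it is not of the form $na$ with $a\in A$, $n\in\mathbb{Z}$, $|n|\geq 2$. A finite index subgroup of a tubular group is tubular with the splitting induced by the action on the Bass–Serre tree; $G$ is virtually primitive if some finite index subgroup, with the induced splitting, is primitive. Rigid morphisms. Let $G,G'$ be tubular groups with underlying graphs $\Gamma,\Gamma'$. A rigid morphism $f:G\to G'$ is a homomorphism together with an isomorphism $f_*:\Gamma\to\Gamma'$ of undirected graphs and injective homomorphisms $f_v:G_v\to G'_{f_*(v)}$, $f_e:G_e\to G'_{f_*(e)}$ which are the restrictions of $f$ to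 vertex and edge groups and are compatible with the attaching maps (at each end of each edge $e$, attaching and then applying $f_v$ agrees with applying $f_e$ and then attaching in $G'$), where $f$ is the homomorphism induced by these data, taking stable letters to corresponding stable letters. $G$ has a primitive target if there is a rigid morphism $G\to\overline G$ with $\overline G$ a primitive tubular group. $G$ has a primitive domain if there is a rigid morphism $\underline G\to G$ with $\underline G$ a primitive tubular group. Regulating tuples. Let $\underline{k}=(k_e)_{e\in\mathcal{E}}$ be an $\mathcal{E}$-tuple of integers. Put $G_e^{(\underline k)}=k_eG_e$ and let $G_v^{(\underline k)}\leq G_v$ be the subgroup generated by the images of the groups $G_e^{(\underline k)}$ under all attaching maps into $G_v$. The tuple $\underline k$ is regulating if for each edge $e$ and generator $g_e$ of $G_e$, each of the elements $\varphi_e^{+}(k_eg_e)$, $\varphi_e^{-}(k_eg_e)$ is primitive in $G^{(\underline k)}_{+e}$, $G^{(\underline k)}_{-e}$ respectively. Other. A group is residually finite if every nontrivial element survives in some finite quotient. A subgroup $H\leqslant G$ is separable if it is the intersection of finite index subgroups of $G$. *)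

(* Defs.v *)
From HB Require Import structures.
From mathcomp Require Import all_boot all_algebra.
From mathcomp Require Import boolp classical_sets cardinality.

Set Implicit Arguments.
Unset Strict Implicit.
Unset Printing Implicit Defensive.

Import GRing.Theory.

Local Open Scope classical_set_scope.
Local Open Scope quotient_scope.
Local Open Scope group_scope.

Section Presentation.
Variable X : choiceType.

(* The letter (x, true) stands for x and (x, false) for its inverse. *)
Definition word : Type := seq (X * bool).

Definition letterV (l : X * bool) : X * bool := (l.1, ~~ l.2).
Definition wordV (w : word) : word := rev (map letterV w).

Variable R : word -> word -> Prop.

Inductive pres_eq : word -> word -> Prop :=
| pres_rel u v of R u v : pres_eq u v
| pres_cancel l : pres_eq [:: l; letterV l] [::]
| pres_refl u : pres_eq u u
| pres_sym u v of pres_eq u v : pres_eq v u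
| pres_trans v u w of pres_eq u v & pres_eq v w : pres_eq u w
| pres_cat u u' v v' of pres_eq u u' & pres_eq v v' :
    pres_eq (u ++ v) (u' ++ v').

Definition pres_eqb : rel word := fun u v => `[< pres_eq u v >].

Lemma pres_eqb_equiv : equiv_class_of pres_eqb.
Proof.
split=> [u|u v|v u w].
- exact/asboolP/pres_refl.
- by apply/asboolP/asboolP; apply: pres_sym.
- by move=> /asboolP uv /asboolP vw; apply/asboolP/(pres_trans uv vw).
Qed.

Canonical pres_equiv := EquivRelPack pres_eqb_equiv.

Definition presented : Type := {eq_quot pres_equiv}.
HB.instance Definition _ := Choice.on presented.

Definition pres_class (w : word) : presented := \pi_({eq_quot pres_equiv}) w.
Definition pres_repr (x : presented) : word := repr (x : {eq_quot pres_equiv}).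

Lemma pres_classP u v : reflect (pres_class u = pres_class v) `[< pres_eq u v >].
Proof. exact: EquivQuot.eqmodP. Qed.

Lemma pres_class_eq u v : pres_class u = pres_class v <-> pres_eq u v.
Proof. by split=> [/pres_classP/asboolP|/asboolP/pres_classP]. Qed.

Lemma pres_reprK x : pres_class (pres_repr x) = x.
Proof. exact: reprK. Qed.

Lemma pres_repr_eq w : pres_eq (pres_repr (pres_class w)) w.
Proof. by apply/pres_class_eq; rewrite pres_reprK. Qed.

Lemma letterVK : involutive letterV.
Proof. by case=> x b; rewrite /letterV /= negbK. Qed.

Lemma wordVK : involutive wordV.
Proof.
by move=> w; rewrite /wordV map_rev revK -map_comp map_id_in // => l _ /=;
   rewrite letterVK.
Qed.

Lemma pres_eqVr w : pres_eq (w ++ wordV w) [::].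
Proof.
elim: w => [|l w IH]; first exact: pres_refl.
rewrite /wordV /= rev_cons -cats1 -/(wordV w) -cat_cons catA.
apply: pres_trans (pres_cancel l).
apply: (@pres_cat _ [:: l] _ _ _ (pres_refl [:: letterV l])).
exact: (@pres_cat [:: l] [:: l] _ [::] (pres_refl _) IH).
Qed.

Lemma pres_eqVl w : pres_eq (wordV w ++ w) [::].
Proof. by rewrite -{2}[w]wordVK; apply: pres_eqVr. Qed.

Lemma pres_eqV u v : pres_eq u v -> pres_eq (wordV u) (wordV v).
Proof.
move=> uv; rewrite -[wordV u]cats0.
apply: (pres_trans (v := wordV u ++ (v ++ wordV v))).
  by apply: pres_cat (pres_refl _) _; apply/pres_sym/pres_eqVr.
rewrite catA -[X in pres_eq _ X]cat0s; apply: pres_cat (pres_refl _).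
apply: pres_trans (pres_eqVl u); apply: pres_cat (pres_refl _) _.
exact: pres_sym.
Qed.

Definition pres_one : presented := pres_class [::].
Definition pres_mul (x y : presented) : presented :=
  pres_class (pres_repr x ++ pres_repr y).
Definition pres_inv (x : presented) : presented :=
  pres_class (wordV (pres_repr x)).

Lemma pres_mulE u v :
  pres_mul (pres_class u) (pres_class v) = pres_class (u ++ v).
Proof. by apply/pres_class_eq/pres_cat; apply: pres_repr_eq. Qed.

Lemma pres_invE u : pres_inv (pres_class u) = pres_class (wordV u).
Proof. exact/pres_class_eq/pres_eqV/pres_repr_eq. Qed.

Lemma pres_mulA : associative pres_mul.
Proof.
move=> x y z; rewrite -[x]pres_reprK -[y]pres_reprK -[z]pres_reprK.
by rewrite !pres_mulE catA.
Qed.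

Lemma pres_mul1g : left_id pres_one pres_mul.
Proof. by move=> x; rewrite -[x]pres_reprK pres_mulE. Qed.

Lemma pres_mulg1 : right_id pres_one pres_mul.
Proof. by move=> x; rewrite -[x]pres_reprK pres_mulE cats0. Qed.

Lemma pres_mulVg : left_inverse pres_one pres_inv pres_mul.
Proof.
move=> x; rewrite -[x]pres_reprK pres_invE pres_mulE.
exact/pres_class_eq/pres_eqVl.
Qed.

Lemma pres_mulgV : right_inverse pres_one pres_inv pres_mul.
Proof.
move=> x; rewrite -[x]pres_reprK pres_invE pres_mulE.
exact/pres_class_eq/pres_eqVr.
Qed.

HB.instance Definition _ := isGroup.Build presented
  pres_mulA pres_mul1g pres_mulg1 pres_mulVg pres_mulgV.

Definition pres_gen (x : X) : presented := pres_class [:: (x, true)].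

End Presentation.

Section Groups.
Variable G : groupType.
Implicit Types (H K N A B C : set G) (g : G).

Definition subgroup H : Prop :=
  H 1 /\ forall x y, H x -> H y -> H (x * y^-1).

Definition ltranslate g C : set G := [set g * x | x in C].
Definition rtranslate C g : set G := [set x * g | x in C].
Definition setprod A B : set G := [set x * y | x in A & y in B].

Definition finite_index H : Prop :=
  subgroup H /\ finite_set (range (fun g => ltranslate g H)).

Definition normal_subgroup N : Prop :=
  subgroup N /\ forall g x, N x -> N (g * x * g^-1).

(* g survives in the finite quotient G / N. *)
Definition residually_finite : Prop :=
  forall g, g <> 1 -> exists N, [/\ normal_subgroup N, finite_index N & ~ N g].

Definition separable H : Prop :=
  exists F : set (set G),
    (forall K, F K -> finite_index K) /\ H = \bigcap_(K in F) K.

End Groups.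

Arguments residually_finite : clear implicits.

Section AbelianGroups.
Variable A : zmodType.
Implicit Types (S C : set A) (a b : A).

Definition zsubgroup S : Prop :=
  S 0%R /\ forall x y, S x -> S y -> S (x - y)%R.

Definition cyclic_subgroup a : set A := [set (a *~ n)%R | n in [set: int]].

Definition maximal_cyclic C : Prop :=
  (exists a, C = cyclic_subgroup a) /\
  (forall b, C `<=` cyclic_subgroup b -> C = cyclic_subgroup b).

Definition primitive_in S a : Prop :=
  [/\ S a, a <> 0%R &
      forall (b : A) (n : int), S b -> (2 <= `|n|)%N -> a <> (b *~ n)%R].

End AbelianGroups.

(* The end of e labelled false is its initial vertex -e and the end labelled  *)
(* true is its terminal vertex +e; attach e false and attach e true are the   *)
(* attaching maps phi_e^- and phi_e^+.                                        *)
Record graph_of_groups := GraphOfGroups {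
  vertex : finType;
  edge : finType;
  endpoint : edge -> bool -> vertex;
  vgroup : vertex -> zmodType;
  egroup : edge -> zmodType;
  attach : forall (e : edge) (b : bool),
    {additive egroup e -> vgroup (endpoint e b)}
}.

Arguments endpoint {g} e b.
Arguments vgroup {g} v.
Arguments egroup {g} e.
Arguments attach {g} e b.

Section Walks.
Variable D : graph_of_groups.

(* (e, true) is e traversed from -e to +e, and (e, false) is e traversed      *)
(* backwards.                                                                 *)
Definition dart : Type := (edge D * bool)%type.

Definition dart_from (d : dart) : vertex D := endpoint d.1 (~~ d.2).
Definition dart_to (d : dart) : vertex D := endpoint d.1 d.2.

Fixpoint walk (v : vertex D) (p : seq dart) (w : vertex D) : bool :=
  if p is d :: q then (dart_from d == v) && walk (dart_to d) q w else v == w.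

Definition reduced_walk (p : seq dart) : bool :=
  sorted (fun d d' : dart => d' != (d.1, ~~ d.2)) p.

Definition connected_graph : Prop :=
  (exists v : vertex D, True) /\
  (forall v w : vertex D, exists p, walk v p w).

Definition spanning_tree (T : {set edge D}) : Prop :=
  (exists v : vertex D, True) /\
  (forall v w : vertex D, exists! p : seq dart,
     [/\ walk v p w, reduced_walk p & all (fun d : dart => d.1 \in T) p]).

End Walks.

Definition tubular (D : graph_of_groups) : Prop :=
  [/\ connected_graph D,
      forall v : vertex D,
        exists f : {additive (int * int)%type -> vgroup v}, bijective f,
      forall e : edge D, exists f : {additive int -> egroup e}, bijective f &
      forall (e : edge D) (b : bool), injective (attach e b)].

Definition primitive (D : graph_of_groups) : Prop :=
  forall (e : edge D) (b : bool), maximal_cyclic (range (attach e b)).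

(* A tubular group together with its splitting; the spanning tree is the one  *)
(* used to present the fundamental group.                                     *)
Record tubular_group := TubularGroup {
  splitting :> graph_of_groups;
  splittingP : tubular splitting;
  tree : {set edge splitting};
  treeP : spanning_tree tree
}.

Section FundamentalGroup.
Variable G : tubular_group.

(* inl (v, a) is the element a of the vertex group at v, and inr e is the     *)
(* stable letter of e.                                                        *)
Definition pi1_generator : choiceType :=
  ({v : vertex G & vgroup v} + edge G)%type.

Definition vletter (v : vertex G) (a : vgroup v) : pi1_generator * bool :=
  (inl (Tagged vgroup a), true).
Definition tletter (e : edge G) : pi1_generator * bool := (inr e, true).

Inductive pi1_relation : word pi1_generator -> word pi1_generator -> Prop :=
| pi1_vertex (v : vertex G) (a b : vgroup v) :
    pi1_relation [:: vletter a; vletter b] [:: vletter (a + b)%R]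
| pi1_edge (e : edge G) (x : egroup e) :
    pi1_relation [:: vletter (attach e false x); tletter e]
                 [:: tletter e; vletter (attach e true x)]
| pi1_tree (e : edge G) of e \in tree G :
    pi1_relation [:: tletter e] [::].

Definition pi1 : groupType := presented pi1_relation.

Definition in_vertex (v : vertex G) (a : vgroup v) : pi1 :=
  pres_gen pi1_relation (inl (Tagged vgroup a)).
Definition stable_letter (e : edge G) : pi1 := pres_gen pi1_relation (inr e).

(* G_e is embedded in the fundamental group through phi_e^-; the image of     *)
(* phi_e^+ is its conjugate by the stable letter of e.                        *)
Definition in_edge (e : edge G) (x : egroup e) : pi1 :=
  in_vertex (attach e false x).

Definition vertex_subgroup (v : vertex G) : set pi1 := range (@in_vertex v).
Definition edge_subgroup (e : edge G) : set pi1 := range (@in_edge e).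

Definition separable_edge_groups : Prop :=
  forall e : edge G, separable (edge_subgroup e).

End FundamentalGroup.

(* The isomorphism of undirected graphs may reverse edges: rm_flip e says     *)
(* whether e is mapped to rm_edge e with its ends exchanged. In               *)
(* rm_attach both sides live in groups attached to the equal vertices of      *)
(* rm_endpoint, whence the tagged equality.                                   *)
Record rigid_morphism (G G' : tubular_group) := RigidMorphism {
  rm_hom : {multiplicative pi1 G -> pi1 G'};
  rm_vertex : vertex G -> vertex G';
  rm_edge : edge G -> edge G';
  rm_flip : edge G -> bool;
  rm_vgroup : forall v : vertex G,
    {additive vgroup v -> vgroup (rm_vertex v)};
  rm_egroup : forall e : edge G, {additive egroup e -> egroup (rm_edge e)};
  rm_vertex_bij : bijective rm_vertex;
  rm_edge_bij : bijective rm_edge;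
  rm_endpoint : forall (e : edge G) (b : bool),
    endpoint (rm_edge e) (b (+) rm_flip e) = rm_vertex (endpoint e b);
  rm_vgroup_inj : forall v, injective (rm_vgroup v);
  rm_egroup_inj : forall e, injective (rm_egroup e);
  rm_attach : forall (e : edge G) (b : bool) (x : egroup e),
    Tagged vgroup (attach (rm_edge e) (b (+) rm_flip e) (rm_egroup e x)) =
    Tagged vgroup (rm_vgroup (endpoint e b) (attach e b x));
  rm_tree : forall e : edge G, (rm_edge e \in tree G') = (e \in tree G);
  rm_hom_vertex : forall (v : vertex G) (a : vgroup v),
    rm_hom (in_vertex a) = in_vertex (rm_vgroup v a);
  rm_hom_stable : forall e : edge G,
    rm_hom (stable_letter e) =
    if rm_flip e then (stable_letter (rm_edge e))^-1
    else stable_letter (rm_edge e)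
}.

Definition has_primitive_target (G : tubular_group) : Prop :=
  exists2 G' : tubular_group, inhabited (rigid_morphism G G') & primitive G'.

Definition has_primitive_domain (G : tubular_group) : Prop :=
  exists2 G' : tubular_group, inhabited (rigid_morphism G' G) & primitive G'.

Section BassSerre.
Variable G : tubular_group.

(* The vertex g G_v of the Bass-Serre tree is encoded as the pair (v, g G_v), *)
(* and the edge g G_e as (e, g G_e).                                          *)
Definition bs_vertex : set (vertex G * set (pi1 G)) :=
  [set p | exists g, p.2 = ltranslate g (vertex_subgroup p.1)].
Definition bs_edge : set (edge G * set (pi1 G)) :=
  [set p | exists g, p.2 = ltranslate g (edge_subgroup p.1)].

(* The edge g G_e goes from g G_{-e} to g t_e G_{+e}. *)
Definition bs_endpoint (p : edge G * set (pi1 G)) (b : bool) :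
    vertex G * set (pi1 G) :=
  let v := endpoint p.1 b in
  (v, setprod (if b then rtranslate p.2 (stable_letter p.1) else p.2)
              (vertex_subgroup v)).

Definition bs_act (I : Type) (g : pi1 G) (p : I * set (pi1 G)) :
    I * set (pi1 G) := (p.1, ltranslate g p.2).

Definition bs_stabilizer (I : Type) (H : set (pi1 G))
    (p : I * set (pi1 G)) : set (pi1 G) :=
  [set h | H h /\ bs_act h p = p].

(* D is a quotient graph of groups for the action of H on the Bass-Serre      *)
(* tree: its vertices and edges are the H-orbits, with chosen representatives *)
(* is_vrep and is_erep; its groups are the stabilizers of the                 *)
(* representatives, through is_vgroup and is_egroup; and its attaching maps   *)
(* are the inclusions of stabilizers followed by conjugation by elements      *)
(* is_conj of H moving the ends of representative edges to representative     *)
(* vertices.                                                                  *)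
Record induced_splitting (H : set (pi1 G)) (D : graph_of_groups) :=
  InducedSplitting {
  is_vrep : vertex D -> vertex G * set (pi1 G);
  is_erep : edge D -> edge G * set (pi1 G);
  is_vgroup : forall v : vertex D, vgroup v -> pi1 G;
  is_egroup : forall e : edge D, egroup e -> pi1 G;
  is_conj : edge D -> bool -> pi1 G;
  is_vrepP : forall v, bs_vertex (is_vrep v);
  is_erepP : forall e, bs_edge (is_erep e);
  is_vorbit : forall p, bs_vertex p ->
    exists! v, exists2 h, H h & p = bs_act h (is_vrep v);
  is_eorbit : forall p, bs_edge p ->
    exists! e, exists2 h, H h & p = bs_act h (is_erep e);
  is_vgroupD : forall v (a b : vgroup v),
    is_vgroup (a + b)%R = is_vgroup a * is_vgroup b;
  is_vgroup_inj : forall v, injective (@is_vgroup v);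
  is_vgroup_range : forall v,
    range (@is_vgroup v) = bs_stabilizer H (is_vrep v);
  is_egroupD : forall e (x y : egroup e),
    is_egroup (x + y)%R = is_egroup x * is_egroup y;
  is_egroup_inj : forall e, injective (@is_egroup e);
  is_egroup_range : forall e,
    range (@is_egroup e) = bs_stabilizer H (is_erep e);
  is_conjP : forall e b, H (is_conj e b);
  is_conj_endpoint : forall e b,
    bs_act (is_conj e b) (bs_endpoint (is_erep e) b) =
    is_vrep (endpoint e b);
  is_attach : forall e b (x : egroup e),
    is_vgroup (attach e b x) =
    is_conj e b * is_egroup x * (is_conj e b)^-1
}.

Definition virtually_primitive : Prop :=
  exists H : set (pi1 G), finite_index H /\
    exists D : graph_of_groups,
      [/\ inhabited (induced_splitting H D), tubular D & primitive D].

End BassSerre.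

Section Regulating.
Variables (G : tubular_group) (k : edge G -> int).

Inductive attached_multiple : forall v : vertex G, vgroup v -> Prop :=
| AttachedMultiple (e : edge G) (b : bool) (x : egroup e) :
    attached_multiple (attach e b (x *~ k e)%R).

Definition vgroup_multiple (v : vertex G) : set (vgroup v) :=
  smallest (@zsubgroup (vgroup v)) (@attached_multiple v).

Definition regulating : Prop :=
  forall (e : edge G) (g : egroup e),
    cyclic_subgroup g = [set: egroup e] ->
    forall b : bool,
      primitive_in (@vgroup_multiple (endpoint e b))
                   (attach e b (g *~ k e)%R).

End Regulating.

Definition has_regulating_tuple (G : tubular_group) : Prop :=
  exists k : edge G -> int, regulating k.

(* Main.v *)
From HB Require Import structures.
Require Import Defs.
From mathcomp Require Import all_boot all_order all_algebra.
From mathcomp Require Import boolp classical_sets cardinality.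
From mathcomp Require Import zify ring.

(** Everything goes through regulating tuples, by way of coordinates: vertex
    groups are copies of the integer plane, and each end of an edge is given by
    a nonzero vector.

    From a regulating tuple to the other properties. The subgroups generated by
    the multiples of the edge groups, enlarged to rank 2, are lattices in which
    these multiples are unimodular. This gives a primitive group with the same
    graph, mapping to G with image of finite index in each vertex group; up to
    a common exponent these inclusions can be inverted, so the same group is
    also a target of G ([primitive_model], [regulating_model]). In a primitive
    target the two ends of an edge differ by a matrix of determinant 1, so G
    acts affinely on the plane over the integers modulo n; the kernel of this
    action, for n the exponent, meets each vertex group in the vertex group of
    the model, and the splitting it inherits is primitive
    ([model_virtually_primitive]). With several copies of the plane and stable
    letters allowed to exchange finitely many orbits, the action can be made to
    send a point along any given reduced path, from copy to copy
    ([affine_representation]). As lines spanned by multiples of unimodular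
    vectors are closed for congruences, a path that is reduced in G stays
    reduced modulo some n. This shows that nontrivial elements, and elements
    outside an edge group, are seen by finite quotients ([model_quotient]).

    Towards a regulating tuple. Primitive domains and targets yield one by
    their indices. In the three other cases the coset of an edge group through
    a root of one of its elements, lying outside it, avoids a normal subgroup
    of finite index ([edges_isolable]). For separable edge groups this is
    immediate, and for a virtually primitive group the normal core of the
    primitive subgroup works. For a residually finite group, take a root a of
    an edge element outside the edge group, and x outside it in the vertex
    group at the other end: the commutator of a and x is nontrivial, depends
    only on the coset of a, and so does not survive in a quotient where that
    coset meets the kernel. Nontriviality is the path representation again,
    over the rationals, where every nonzero vector is unimodular. A root
    closure contains finitely many cosets of an edge group, so one normal
    subgroup N avoids all of them at once, and the indices of N in the edge
    groups are a regulating tuple ([isolable_regulating]). *)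

Set Implicit Arguments.
Unset Strict Implicit.
Unset Printing Implicit Defensive.

Import Order.TTheory GRing.Theory Num.Theory.

Local Open Scope classical_set_scope.
Local Open Scope group_scope.

(** * Morphisms from presented groups *)

Definition multiplicative_of (K L : groupType) (f : K -> L)
    (fM : {morph f : x y / x * y}) : {multiplicative K -> L} :=
  HB.pack_for {multiplicative K -> L} f (isMultiplicative.Build K L f fM).

Definition additive_of (A B : zmodType) (f : A -> B)
    (fB : {morph f : x y / (x - y)%R}) : {additive A -> B} :=
  HB.pack_for {additive A -> B} f (GRing.isZmodMorphism.Build A B f fB).

Lemma mult1 (K L : groupType) (F : {multiplicative K -> L}) : F 1 = 1.
Proof. by apply: (mulgI (F 1)); rewrite -gmulfM !mulg1. Qed.

Lemma multV (K L : groupType) (F : {multiplicative K -> L}) x :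
  F x^-1 = (F x)^-1.
Proof. by apply/esym/mulg1_eq; rewrite -gmulfM mulgV mult1. Qed.

Section PresentedGroups.
Variables (X : choiceType) (R : word X -> word X -> Prop).

Lemma pres_classM u v :
  (pres_class R u : presented R) * pres_class R v = pres_class R (u ++ v).
Proof. exact: pres_mulE. Qed.

Lemma presented_ind (P : presented R -> Prop) :
    P 1 -> (forall x g, P g -> P (pres_gen R x * g)) ->
    (forall x g, P g -> P ((pres_gen R x)^-1 * g)) ->
  forall g, P g.
Proof.
move=> P1 Pgen PgenV g; rewrite -[g]pres_reprK.
elim: (pres_repr g) => [//|[x b] w IH].
have -> : pres_class R ((x, b) :: w) =
    (if b then pres_gen R x else (pres_gen R x)^-1) * pres_class R w.
  have inv_gen : (pres_gen R x)^-1 = pres_class R [:: (x, false)].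
    exact: pres_invE.
  by case: b; rewrite ?inv_gen pres_classM.
by case: b; [exact: Pgen | exact: PgenV].
Qed.

Variables (K : groupType) (h : X -> K).

Definition letter_val (l : X * bool) : K := if l.2 then h l.1 else (h l.1)^-1.
Definition word_val (w : word X) : K := \prod_(l <- w) letter_val l.

Hypothesis hR : forall u v, R u v -> word_val u = word_val v.

Lemma word_val_pres_eq u v : pres_eq R u v -> word_val u = word_val v.
Proof.
elim=> [{}u {}v /hR //|[x b]|//|{}u {}v _ <- //||].
- rewrite /word_val big_cons big_seq1 big_nil /letter_val /=.
  by case: b; rewrite /= ?mulgV ?mulVg.
- by move=> {}u {}v w _ -> _ ->.
- by move=> {}u u' {}v v' _ uu' _ vv';
    rewrite /word_val !big_cat /= -!/(word_val _) uu' vv'.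
Qed.

Definition presented_lift (x : presented R) : K := word_val (pres_repr x).

Lemma presented_liftE w : presented_lift (pres_class R w) = word_val w.
Proof. exact/word_val_pres_eq/pres_repr_eq. Qed.

Lemma presented_liftM : {morph presented_lift : x y / x * y}.
Proof.
move=> x y; rewrite -[x]pres_reprK -[y]pres_reprK.
by rewrite pres_classM !presented_liftE /word_val big_cat.
Qed.

Lemma presented_lift_gen x : presented_lift (pres_gen R x) = h x.
Proof. by rewrite presented_liftE /word_val big_seq1. Qed.

End PresentedGroups.

(** * Finite index *)

Section FiniteIndex.
Variable G : groupType.
Implicit Types (H K N : set G).

Lemma subgroup1 H : subgroup H -> H 1.
Proof. by case. Qed.

Lemma subgroupV H x : subgroup H -> H x -> H x^-1.
Proof. by move=> [H1 HM] Hx; rewrite -[x^-1]mul1g; apply: HM. Qed.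

Lemma subgroupM H x y : subgroup H -> H x -> H y -> H (x * y).
Proof.
by move=> sH Hx Hy; rewrite -[y]invgK; apply: sH.2 => //; apply: subgroupV.
Qed.

Lemma subgroupX H x n : subgroup H -> H x -> H (x ^+ n).
Proof.
move=> sH Hx; elim: n => [|n IH]; first exact: subgroup1.
by rewrite expgS; apply: subgroupM.
Qed.

Lemma normalJ N g x : normal_subgroup N -> N (g * x * g^-1) <-> N x.
Proof.
move=> nN; split; last exact: nN.2.
by move=> /(nN.2 g^-1); rewrite invgK !mulgA mulVg mul1g mulgVK.
Qed.

(** A labelling of the left cosets of H by a finite type: unlike finiteness
    of the set of cosets, it passes to intersections and normal cores by
    plain constructions on the labels. *)
Definition coset_code H (T : finType) (c : G -> T) : Prop :=
  forall x y, c x = c y <-> H (x^-1 * y).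

Lemma eq_ltranslate H x y : subgroup H ->
  ltranslate x H = ltranslate y H <-> H (x^-1 * y).
Proof.
move=> sH; split=> [xy|Hxy].
  have : ltranslate y H y by exists 1; [exact: subgroup1|rewrite mulg1].
  by rewrite -xy => -[z Hz <-]; rewrite mulKg.
apply/seteqP; split=> z [w Hw <-].
  exists (y^-1 * x * w); last by rewrite !mulgA mulgV mul1g.
  apply: subgroupM => //; rewrite -[y^-1 * x]invgK invgM invgK.
  exact: subgroupV.
by exists (x^-1 * y * w); [exact: subgroupM|rewrite !mulgA mulgV mul1g].
Qed.

Lemma code_finite_index H (T : finType) (c : G -> T) :
  subgroup H -> coset_code H c -> finite_index H.
Proof.
move=> sH cH; split=> //.
have [x0|no_x] := pselect (exists x : G, True); last first.
  by exfalso; apply: no_x; exists 1.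
pose rep t : G :=
  if pselect (exists x, c x = t) is left p then sval (cid p) else 1.
have repE x : ltranslate (rep (c x)) H = ltranslate x H.
  apply/eq_ltranslate/cH => //; rewrite /rep.
  by case: pselect => [p|]; [rewrite (svalP (cid p))|case; exists x].
apply: (@sub_finite_set _ _ [set ltranslate (rep t) H | t in [set: T]]).
  by move=> _ [x _ <-]; exists (c x); rewrite ?repE.
exact/finite_image/finite_finset.
Qed.

Lemma finite_index_code H : finite_index H ->
  exists (T : finType) (c : G -> T), coset_code H c.
Proof.
move=> [sH [n /card_set_bijP[f bij_f]]].
have ltf x : (f (ltranslate x H) < n.+1)%N.
  have rx : range (fun g => ltranslate g H) (ltranslate x H) by exists x.
  by have [f_fun _ _] := bij_f; exact/leqW/(f_fun _ rx).
exists 'I_n.+1, (fun x => Ordinal (ltf x)) => x y.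
apply: iff_trans (eq_ltranslate x y sH); split=> [[]|eq_xy]; last first.
  by apply/val_inj; rewrite /= eq_xy.
have [_ inj_f _] := bij_f.
by apply: inj_f => //; apply/mem_set; [exists x|exists y].
Qed.

Lemma normal_setT : normal_subgroup [set: G].
Proof. by []. Qed.

Lemma finite_index_setT : finite_index [set: G].
Proof. by apply: (@code_finite_index _ unit (fun=> tt)). Qed.

Lemma normalI N1 N2 : normal_subgroup N1 -> normal_subgroup N2 ->
  normal_subgroup (N1 `&` N2).
Proof.
move=> [[N1_1 N1M] N1J] [[N2_1 N2M] N2J]; split; first split => //.
  by move=> x y [? ?] [? ?]; split; [exact: N1M|exact: N2M].
by move=> g x [? ?]; split; [exact: N1J|exact: N2J].
Qed.

Lemma finite_indexI H K :
  finite_index H -> finite_index K -> finite_index (H `&` K).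
Proof.
move=> fH fK; have [T [c cP]] := finite_index_code fH.
have [U [d dP]] := finite_index_code fK.
have [[[H1 HM] _] [[K1 KM] _]] := (fH, fK).
apply: (@code_finite_index _ (T * U)%type (fun x => (c x, d x))).
  by split=> // x y [? ?] [? ?]; split; [exact: HM|exact: KM].
move=> x y; split=> [[/cP ? /dP ?]//|[/cP -> /dP -> //]].
Qed.

Lemma finite_index_bigI (I : finType) (P : I -> set G -> Prop) :
    (forall i N M, P i N -> M `<=` N -> P i M) ->
    (forall i, exists N, [/\ normal_subgroup N, finite_index N & P i N]) ->
  exists N, [/\ normal_subgroup N, finite_index N & forall i, P i N].
Proof.
move=> Pmono exN.
suff [N [nN fN PN]] : exists N, [/\ normal_subgroup N, finite_index N &
    forall i, i \in enum I -> P i N].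
  by exists N; split=> // i; apply: PN; rewrite mem_enum.
elim: (enum I) => [|i s [N [nN fN PN]]].
  by exists [set: G]; split=> //; exact: finite_index_setT.
have [M [nM fM PM]] := exN i.
exists (M `&` N); split; [exact: normalI|exact: finite_indexI|].
move=> j; rewrite inE => /predU1P[->|/PN PjN];
  first by apply: Pmono PM _ => x [].
by apply: Pmono PjN _ => x [].
Qed.

Lemma finite_index_sup H K :
  finite_index H -> subgroup K -> H `<=` K -> finite_index K.
Proof.
move=> fH sK subHK; have [T [c cP]] := finite_index_code fH.
apply: (@code_finite_index _ _
    (fun x => finset (fun t => `[< exists2 k, K k & c (x * k) = t >]))) =>
      // x y.
split=> [/setP/(_ (c x))|Kxy].
  rewrite !inE; have -> : `[< exists2 k, K k & c (x * k) = c x >].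
    by apply/asboolP; exists 1; [exact: subgroup1|rewrite mulg1].
  move=> /esym/asboolP[k Kk /esym/cP/subHK Kxyk].
  by rewrite -[_ * y](mulgK k); apply: sK.2 => //; rewrite -mulgA.
apply/setP => t; rewrite !inE; apply/asboolP/asboolP => -[k Kk <-].
  exists (y^-1 * x * k); last by rewrite !mulgA mulgV mul1g.
  apply: subgroupM => //; rewrite -[y^-1 * x]invgK invgM invgK.
  exact: subgroupV.
by exists (x^-1 * y * k); [exact: subgroupM|rewrite !mulgA mulgV mul1g].
Qed.

(** The core is the kernel of the action on cosets: it is labelled by
    functions on the labels of H. *)
Lemma exists_normal_core H : finite_index H ->
  exists N, [/\ normal_subgroup N, finite_index N & N `<=` H].
Proof.
move=> fH; have [T [c cP]] := finite_index_code fH; have [sH _] := fH.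
pose N : set G := [set h | forall x, H (x^-1 * h * x)].
have nN : normal_subgroup N.
  split; first split.
  - by move=> x; rewrite mulg1 mulVg; exact: subgroup1.
  - move=> x y Nx Ny z.
    have -> : z^-1 * (x * y^-1) * z = (z^-1 * x * z) * (z^-1 * y * z)^-1.
      by rewrite !invgM invgK !mulgA mulgK.
    by apply: sH.2.
  - move=> g x Nx z; have := Nx (g^-1 * z).
    by rewrite invgM invgK !mulgA.
exists N; split=> //; last by move=> h /(_ 1); rewrite invg1 mul1g mulg1.
pose rep t : G :=
  if pselect (exists x, c x = t) is left p then sval (cid p) else 1.
have repE x : c (rep (c x)) = c x.
  by rewrite /rep; case: pselect => [p|[]]; [rewrite (svalP (cid p))|exists x].
apply: (@code_finite_index _ {ffun T -> T} (fun g =>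
  [ffun t => c (g * rep t)])).
  by case: nN.
move=> g h; split=> [/ffunP gh x|Ngh].
  have := gh (c x); rewrite !ffunE => /cP Hgh.
  have /cP Hx := repE x.
  pose y := (rep (c x))^-1 * x.
  have -> : x^-1 * (g^-1 * h) * x =
      y^-1 * ((g * rep (c x))^-1 * (h * rep (c x))) * y.
    by rewrite /y !invgM invgK !mulgA !mulgK.
  by apply: subgroupM => //; apply: subgroupM => //; apply: subgroupV.
apply/ffunP => t; rewrite !ffunE; apply/cP.
by rewrite invgM !mulgA -[_ * _ * h]mulgA; apply: Ngh.
Qed.

Lemma finite_index_power H x : finite_index H ->
  exists2 n, (0 < n)%N & H (x ^+ n).
Proof.
move=> fH; have [T [c cP]] := finite_index_code fH.
have /injectivePn[i [j ne_ij cij]] :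
    ~~ injectiveb (fun i : 'I_#|T|.+1 => c (x ^+ i)).
  by apply/negP => /injectiveP /leq_card; rewrite card_ord ltnn.
wlog lt_ij : i j ne_ij cij / (i < j)%N.
  move=> th; case: (ltngtP i j) => [||/ord_inj eq_ij].
  - exact: th.
  - by apply: th; [rewrite eq_sym|].
  - by rewrite eq_ij eqxx in ne_ij.
exists (j - i)%N; first by rewrite subn_gt0.
move/cP: cij; rewrite -{1}(subnKC (ltnW lt_ij)) expgnDr mulKg //.
Qed.

End FiniteIndex.

(** * Equivariant permutations with prescribed values *)

Section Permutations.
Variable T : Type.

Record permutation := Permutation {
  perm_fun :> T -> T;
  perm_inv : T -> T;
  permutK : cancel perm_fun perm_inv;
  permutVK : cancel perm_inv perm_fun
}.

Lemma eq_permutation (s t : permutation) : s =1 t -> s = t.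
Proof.
case: s t => [s s' sK s'K] [t t' tK t'K] /= st.
have {}st : s = t by apply/funext.
have {}st' : s' = t'.
  by apply/funext => x; rewrite -[LHS]tK -st s'K.
by subst; congr Permutation; exact: Prop_irrelevance.
Qed.

HB.instance Definition _ := gen_eqMixin permutation.
HB.instance Definition _ := gen_choiceMixin permutation.

Definition permutation_one : permutation :=
  @Permutation id id (fun=> erefl) (fun=> erefl).
Definition permutation_inv (s : permutation) : permutation :=
  Permutation (@permutVK s) (@permutK s).
Definition permutation_mul (s t : permutation) : permutation :=
  Permutation (can_comp (@permutK s) (@permutK t))
              (can_comp (@permutVK t) (@permutVK s)).

Lemma permutation_mulA : associative permutation_mul.
Proof. by move=> s t u; apply: eq_permutation. Qed.
Lemma permutation_mul1g : left_id permutation_one permutation_mul.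
Proof. by move=> s; apply: eq_permutation. Qed.
Lemma permutation_mulg1 : right_id permutation_one permutation_mul.
Proof. by move=> s; apply: eq_permutation. Qed.
Lemma permutation_mulVg :
  left_inverse permutation_one permutation_inv permutation_mul.
Proof. by move=> s; apply: eq_permutation => x /=; rewrite permutK. Qed.
Lemma permutation_mulgV :
  right_inverse permutation_one permutation_inv permutation_mul.
Proof. by move=> s; apply: eq_permutation => x /=; rewrite permutVK. Qed.

HB.instance Definition _ := isGroup.Build permutation permutation_mulA
  permutation_mul1g permutation_mulg1 permutation_mulVg permutation_mulgV.

Lemma permM (s t : permutation) x : (s * t) x = s (t x).
Proof. by []. Qed.

End Permutations.

Section Equivariance.
Variables (A : zmodType) (T : eqType).
Implicit Types (a b : A) (s y : (A * T)%type).

Definition shift a s : (A * T)%type := ((s.1 + a)%R, s.2).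

Lemma shiftD a b s : shift a (shift b s) = shift (a + b)%R s.
Proof. by rewrite /shift /= -addrA [(b + a)%R]addrC. Qed.

Lemma shift0 s : shift 0%R s = s.
Proof. by case: s => x i; rewrite /shift addr0. Qed.

Lemma shiftK a : cancel (shift a) (shift (- a)%R).
Proof. by move=> s; rewrite shiftD addNr shift0. Qed.

Lemma shiftVK a : cancel (shift (- a)%R) (shift a).
Proof. by move=> s; rewrite shiftD addrN shift0. Qed.

Definition translation a : permutation (A * T)%type :=
  Permutation (shiftK a) (shiftVK a).

Lemma translationD a b : translation (a + b)%R = translation a * translation b.
Proof. by apply: eq_permutation => s; rewrite permM /= shiftD. Qed.

Definition same_orbit a s s' : Prop := exists k : int, s' = shift (a *~ k)%R s.

Lemma same_orbit_sym a s s' : same_orbit a s s' -> same_orbit a s' s.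
Proof. by move=> [k ->]; exists (- k)%R;
  rewrite shiftD -mulrzDr addNr mulr0z shift0. Qed.

Lemma same_orbit_trans a s s' s'' :
  same_orbit a s s' -> same_orbit a s' s'' -> same_orbit a s s''.
Proof. by move=> [k ->] [l ->]; exists (l + k)%R; rewrite shiftD -mulrzDr. Qed.

Definition equivariant a b (t : A * T -> A * T) : Prop :=
  forall k s, t (shift (a *~ k)%R s) = shift (b *~ k)%R (t s).

(** The permutation exchanging the orbits of y and y' under translation by a,
    and taking y to y'. When y and y' lie in one orbit it is a translation of
    that orbit, and the formula for the inverse is still the same. *)
Definition orbit_swap_fun a y y' s : (A * T)%type :=
  if `[< same_orbit a y s >] then ((s.1 - y.1 + y'.1)%R, y'.2)
  else if `[< same_orbit a y' s >] then ((s.1 - y'.1 + y.1)%R, y.2)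
  else s.

Lemma orbit_swap_fun_equivariant a y y' :
  equivariant a a (orbit_swap_fun a y y').
Proof.
move=> k s; rewrite /orbit_swap_fun.
have orbE z : `[< same_orbit a z (shift (a *~ k)%R s) >] =
    `[< same_orbit a z s >].
  have orb : same_orbit a s (shift (a *~ k)%R s) by exists k.
  by apply/asboolP/asboolP => /same_orbit_trans; apply => //;
    apply: same_orbit_sym.
rewrite !orbE; case: ifP => _; last case: ifP => _ //.
  by rewrite /shift /=; congr pair; rewrite -!addrA; congr (_ + _)%R;
    rewrite addrC !addrA.
by rewrite /shift /=; congr pair; rewrite -!addrA; congr (_ + _)%R;
  rewrite addrC !addrA.
Qed.


Lemma orbit_swap_fun_orbit a y y' k :
  orbit_swap_fun a y y' (shift (a *~ k)%R y) = shift (a *~ k)%R y'.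
Proof.
rewrite /orbit_swap_fun ifT; last by apply/asboolP; exists k.
by rewrite /shift /=; congr pair; rewrite [(_ + a *~ k)%R]addrC addrK addrC.
Qed.

Lemma orbit_swap_funK a y y' :
  cancel (orbit_swap_fun a y y') (orbit_swap_fun a y' y).
Proof.
move=> s; have [[k ->]|nys] := pselect (same_orbit a y s).
  by rewrite !orbit_swap_fun_orbit.
have nysF : `[< same_orbit a y s >] = false by apply/asboolP.
have [[k def_s]|ny's] := pselect (same_orbit a y' s); last first.
  have ny'sF : `[< same_orbit a y' s >] = false by apply/asboolP.
  by rewrite /orbit_swap_fun nysF ny'sF ny'sF nysF.
have -> : orbit_swap_fun a y y' s = shift (a *~ k)%R y.
  rewrite /orbit_swap_fun nysF ifT; last by apply/asboolP; exists k.
  by rewrite def_s /shift /=; congr pair;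
    rewrite [(_ + a *~ k)%R]addrC addrK addrC.
rewrite /orbit_swap_fun ifF; last first.
  apply/asboolP => /same_orbit_sym y'y; apply: nys.
  by apply: (same_orbit_trans (s' := shift (a *~ k)%R y));
     [exists k|apply: (same_orbit_trans y'y); exists k].
rewrite ifT; last by apply/asboolP; exists k.
by rewrite def_s /shift /=; congr pair;
  rewrite [(_ + a *~ k)%R]addrC addrK addrC.
Qed.

Definition orbit_swap a y y' : permutation (A * T)%type :=
  Permutation (orbit_swap_funK a y y') (orbit_swap_funK a y' y).

Definition independent a b (c c' : (A * T) * (A * T)) : bool :=
  `[< ~ same_orbit a c.1 c'.1 /\ ~ same_orbit b c.2 c'.2 >].

(** Finitely many values of an equivariant permutation can be prescribed, as
    long as no orbit is used twice: correct the values one at a time by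
    exchanging two orbits in the target. As nothing is said about complements
    of finite sets of orbits, this applies to finite and infinite sets alike. *)
Lemma prescribed_equivariant a b (t0 : permutation (A * T)%type) cs :
    equivariant a b t0 -> pairwise (independent a b) cs ->
  exists2 t : permutation (A * T)%type,
    equivariant a b t & {in cs, forall c, t c.1 = c.2}.
Proof.
move=> eq_t0; elim: cs => [|[x y] cs IH] /=; first by exists t0.
case/andP=> /allP ind_xy /IH[t eq_t tcs].
exists (orbit_swap b (t x) y * t).
  by move=> k s; rewrite !permM eq_t [LHS]orbit_swap_fun_equivariant.
move=> c; rewrite inE => /predU1P[->|cs_c].
  rewrite permM /= -[in X in orbit_swap_fun _ _ _ X](shift0 (t x)) -(mulr0z b).
  by rewrite orbit_swap_fun_orbit mulr0z shift0.
have /asboolP[/= nx ny] := ind_xy c cs_c.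
rewrite (tcs c cs_c) /orbit_swap_fun ifF.
  by rewrite ifF //; apply/asboolP.
apply/asboolP => -[k];
  rewrite -(tcs c cs_c) -eq_t => /(can_inj (@permutK _ t)) c1.
by apply: nx; exists k.
Qed.

End Equivariance.

(** * Moving a point along a path *)

Section Paths.
Variables (E : eqType) (A : zmodType).

(** A pair (x, d) of a path is an element x of the vertex group at the start of
    the dart d, followed by d. The vertex groups are all mapped to A, where
    [a e b] is the image of the generator of the edge group of e at its end b. *)
Variable a : E -> bool -> A.

Definition no_pinch (x y : A * (E * bool)) : bool :=
  `[< y.2 = (x.2.1, ~~ x.2.2) ->
      ~ exists k, y.1 = (a y.2.1 (~~ y.2.2) *~ k)%R >].

Definition reduced_path (p : seq (A * (E * bool))) : bool := sorted no_pinch p.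

Variable c : A.

Definition path_head (p : seq (A * (E * bool))) : A := head c (unzip1 p).

Variable L : nat.
Notation S := (A * 'I_L.+1)%type.

(** The value of the stable letters that makes a path of length at most L take
    the point 0 of the copy 0 of A to the copy of A indexed by its length: each
    dart moves on to the point 0 of the next copy. *)
Fixpoint path_constraints (e : E) (p : seq (A * (E * bool))) : seq (S * S) :=
  if p is (_, (e', b)) :: q then
    let x := (path_head q, inord (size q)) in
    let y := (0%R, inord (size q).+1) in
    let cs := path_constraints e q in
    if e' == e then (if b then (x, y) else (y, x)) :: cs else cs
  else [::].

Lemma path_constraints_level e p z :
    (size p <= L)%N -> z \in path_constraints e p ->
  (z.1.2 <= size p)%N && (z.2.2 <= size p)%N.
Proof.
elim: p => [//|[x [e' b]] q IH] /= ltL.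
have IHq : z \in path_constraints e q ->
    (z.1.2 <= (size q).+1)%N && (z.2.2 <= (size q).+1)%N.
  by move=> /(IH (ltnW ltL))/andP[? ?]; rewrite !leqW.
case: eqP => // _; rewrite inE => /predU1P[->|//].
by case: b => /=; rewrite !inordK ?leqnSn ?leqnn // ltnS ?(ltnW ltL).
Qed.

Lemma path_constraints_independent e p :
    (size p <= L)%N -> reduced_path p ->
  pairwise (independent (a e true) (a e false)) (path_constraints e p).
Proof.
elim: p => [//|[x [e' b]] q IH] /= ltL red_p.
have {IH} IHq := IH (ltnW ltL) (path_sorted red_p).
case: eqP => [eq_e|//]; rewrite /= IHq andbT {IHq}; subst e'.
have top z : z \in path_constraints e q ->
    (z.1.2 < (size q).+1)%N /\ (z.2.2 < (size q).+1)%N.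
  by move=> /(path_constraints_level (ltnW ltL))/andP[]; rewrite !ltnS.
have far a' (u : A) (v : S) i : (i.+1 <= L)%N -> (v.2 < i.+1)%N ->
    ~ same_orbit a' (u, inord i.+1) v.
  by move=> lti ltv [k]; case: v ltv => v j /= ltv [_ eqj]; move: ltv;
     rewrite eqj inordK // ltnn.
apply/allP => z zq; have [top1 top2] := top z zq.
suff near : ~ same_orbit (a e b) (path_head q, inord (size q))
                  (if b then z.1 else z.2).
  by apply/asboolP; case: b near {red_p} => near /=; split=> //; apply: far.
case: q zq ltL red_p top {top1 top2} => [//|[x' [e'' b']] r] /= zq ltL.
move=> /andP[/asboolP /= pinch _] _; set u := (x', inord (size r).+1).
have low : z \in path_constraints e r ->
    ~ same_orbit (a e b) u (if b then z.1 else z.2).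
  move=> /(path_constraints_level (ltnW (ltnW ltL)))/andP[le1 le2].
  by apply: far (ltnW ltL) _; case: b {pinch u}; rewrite ltnS.
move: zq; case: eqP => [eq_e|//]; rewrite inE => /predU1P[->|//] {low};
  subst e''.
have far' v : ~ same_orbit (a e b) u (v, inord (size r)).
  by apply: far; rewrite /= ?inordK ?ltnS ?(ltnW ltL) // (ltnW (ltnW ltL)).
have near_x k : ((0 : A) = x' + a e b *~ k)%R -> ~ (e, b') = (e, ~~ b).
  move=> /esym/eqP; rewrite addr_eq0 => /eqP eq_x /[dup] /pinch{}pinch -[eq_b].
  by apply: pinch; exists (- k)%R; rewrite mulrNz eq_b negbK.
case: b b' @u {pinch} near_x far' => -[] u near_x far' /=;
  by [exact: far'|move=> [k [/near_x]]].
Qed.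

Definition dart_perm (t : E -> permutation S) (d : E * bool) : permutation S :=
  if d.2 then t d.1 else (t d.1)^-1.

Definition path_perm (t : E -> permutation S) (p : seq (A * (E * bool))) :=
  \prod_(x <- p) (translation 'I_L.+1 x.1 * dart_perm t x.2).

Lemma path_perm_move (t : E -> permutation S) p :
    (size p <= L)%N ->
    (forall e, {in path_constraints e p, forall z, t e z.1 = z.2}) ->
  (path_perm t p * translation 'I_L.+1 c) (0%R, ord0) =
    (path_head p, inord (size p)).
Proof.
elim: p => [|[x [e b]] q IH] leL tP.
  rewrite /path_perm big_nil mul1g /= /shift /= add0r; congr pair.
  by apply/val_inj; rewrite /= inordK.
rewrite /path_perm big_cons -/(path_perm _ _) -mulgA permM IH; last 2 first.
- exact: ltnW.
- by move=> e' z zq; apply: tP; rewrite /=; case: ifP => _ //;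
    rewrite inE zq orbT.
have := tP e; rewrite /= eqxx => /(_ _ (mem_head _ _)).
rewrite /dart_perm /=; case: b {leL tP} => /= tP.
  by rewrite tP /shift /= add0r.
by rewrite -tP; have /= -> := permutK (t e); rewrite /shift /= add0r.
Qed.

(** Hence a reduced path of positive length moves a point, in a permutation
    representation where the vertex groups act by translations. *)
Lemma reduced_path_permutation (t0 : E -> permutation A) p :
    (forall e k x, t0 e (x + a e true *~ k)%R = (t0 e x + a e false *~ k)%R) ->
    size p = L -> reduced_path p ->
  exists t : E -> permutation S,
    (forall e, equivariant (a e true) (a e false) (t e)) /\
    (path_perm t p * translation 'I_L.+1 c) (0%R, ord0) =
      (path_head p, ord_max).
Proof.
move=> t0P sz_p red_p.
have t0K e : cancel (fun s : S => (t0 e s.1, s.2))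
    (fun s : S => (perm_inv (t0 e) s.1, s.2)).
  by case=> x i /=; rewrite permutK.
have t0VK e : cancel (fun s : S => (perm_inv (t0 e) s.1, s.2))
    (fun s : S => (t0 e s.1, s.2)).
  by case=> x i /=; rewrite permutVK.
have exT e : exists t : permutation S, equivariant (a e true) (a e false) t /\
    {in path_constraints e p, forall z, t z.1 = z.2}.
  have eq_t0 : equivariant (a e true) (a e false)
      (Permutation (t0K e) (t0VK e)).
    by move=> k [x i]; rewrite /shift /= t0P.
  have ind := path_constraints_independent e (eq_leq sz_p) red_p.
  by have [t ? ?] := prescribed_equivariant eq_t0 ind; exists t.
pose t e := sval (cid (exT e)); exists t; split=> [e|].
  by have [] := svalP (cid (exT e)).
rewrite path_perm_move ?sz_p //; last first.
  by move=> e; have [] := svalP (cid (exT e)).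
by congr pair; apply/val_inj; rewrite /= inordK.
Qed.

End Paths.

(** * Morphisms from the fundamental group *)

Section Lifting.
Variables (G : tubular_group) (K : groupType).

Lemma pi1_lift (r : forall v : vertex G, vgroup v -> K) (t : edge G -> K) :
    (forall v (a b : vgroup v), r v (a + b)%R = r v a * r v b) ->
    (forall e (x : egroup e), r _ (attach e false x) * t e =
      t e * r _ (attach e true x)) ->
    (forall e, e \in tree G -> t e = 1) ->
  exists F : {multiplicative pi1 G -> K},
    (forall v (a : vgroup v), F (in_vertex a) = r v a) /\
    (forall e, F (stable_letter e) = t e).
Proof.
move=> rD rt t1.
pose h (x : pi1_generator G) : K :=
  match x with inl u => r (tag u) (tagged u) | inr e => t e end.
have hR u v : @pi1_relation G u v -> word_val h u = word_val h v.
  case=> [w a b|e x|e /t1 te];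
    rewrite /word_val !big_cons ?big_nil /letter_val /= ?mulg1.
  - exact/esym/rD.
  - exact: rt.
  - exact: te.
exists (multiplicative_of (presented_liftM hR)).
by split=> *; apply: presented_lift_gen.
Qed.

Definition dart_val (t : edge G -> K) (d : dart G) : K :=
  if d.2 then t d.1 else (t d.1)^-1.

Definition walk_val (t : edge G -> K) (p : seq (dart G)) : K :=
  \prod_(d <- p) dart_val t d.

End Lifting.

Lemma walk_cat (D : graph_of_groups) (u v w : vertex D) p q :
  walk u p v -> walk v q w -> walk u (p ++ q) w.
Proof.
elim: p u => [|d p IH] u /=; first by move/eqP->.
by case/andP=> -> /IH/[apply].
Qed.

Definition dart_rev (D : graph_of_groups) (d : dart D) : dart D :=
  (d.1, ~~ d.2).

Lemma dart_revK D : involutive (@dart_rev D).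
Proof. by case=> e b; rewrite /dart_rev /= negbK. Qed.

Lemma dart_from_rev D (d : dart D) : dart_from (dart_rev d) = dart_to d.
Proof. by rewrite /dart_from /= negbK. Qed.

Lemma walk_rcons (D : graph_of_groups) (u w : vertex D) p d :
  walk u (rcons p d) w = walk u p (dart_from d) && (dart_to d == w).
Proof.
elim: p u => [|d' p IH] u /=; first by rewrite eq_sym.
by rewrite IH andbA.
Qed.

Section TreePaths.
Variable G : tubular_group.

(** The products along the reduced paths of the tree: uniqueness of these paths
    says that the paths to the ends of an edge of the tree differ by that
    edge. *)
Lemma tree_potential (K : groupType) (t : edge G -> K) (v0 : vertex G) :
  exists g : vertex G -> K, g v0 = 1 /\
    forall e, e \in tree G -> g (endpoint e false) * t e = g (endpoint e true).
Proof.
have [_ treeP] := treeP G.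
pose p v := sval (cid (treeP v0 v)).
have pP v : [/\ walk v0 (p v) v, reduced_walk (p v) &
    all (fun d : dart G => d.1 \in tree G) (p v)].
  by have [] := svalP (cid (treeP v0 v)).
have p_uniq v q : [/\ walk v0 q v, reduced_walk q &
    all (fun d : dart G => d.1 \in tree G) q] -> p v = q.
  by have [_] := svalP (cid (treeP v0 v)); apply.
exists (fun v => walk_val t (p v)); split.
  by rewrite (p_uniq v0 [::]) /walk_val ?big_nil //=; split.
suff step d : d.1 \in tree G ->
    p (dart_from d) = rcons (p (dart_to d)) (dart_rev d) \/
    p (dart_to d) = rcons (p (dart_from d)) d.
  have walk_val_rcons q d :
      walk_val t (rcons q d) = walk_val t q * dart_val t d.
    by rewrite /walk_val -cats1 big_cat big_seq1.
  move=> e /(step (e, true)); rewrite /dart_to /dart_from /=.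
  by case=> ->; rewrite walk_val_rcons // mulgVK.
move=> Td; have [] := pP (dart_from d);
  case/lastP def_p: (p (dart_from d)) => [|q d'].
  move=> /eqP v0d _ _; right; apply: p_uniq; rewrite /= Td v0d /=; split=> //.
  by rewrite !eqxx.
rewrite walk_rcons all_rcons => /andP[walk_q /eqP to_d'] red_q /andP[Td' Tq].
have [eq_d|ne_d] := eqVneq d (dart_rev d').
  left; rewrite {2}eq_d dart_revK; congr rcons; apply/esym/p_uniq.
  by split=> //; [rewrite eq_d -dart_from_rev dart_revK|
                  move: red_q; rewrite /reduced_walk -cats1 => /cat_sorted2[]].
right; apply: p_uniq; split.
- by rewrite !walk_rcons walk_q to_d' !eqxx.
- move: red_q; rewrite /reduced_walk; case: q {walk_q Tq def_p} => [|d0 q] /=.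
    by rewrite ne_d.
  by move=> red_q; rewrite rcons_path red_q last_rcons ne_d.
- by rewrite !all_rcons Td Td'.
Qed.

(** Correcting by the potential makes the letters of the tree trivial, so that
    morphisms can be defined with arbitrary values of the stable letters. *)
Lemma pi1_lift_conj (K : groupType) (r : forall v : vertex G, vgroup v -> K)
    (t : edge G -> K) (v0 : vertex G) :
    (forall v (a b : vgroup v), r v (a + b)%R = r v a * r v b) ->
    (forall e (x : egroup e), r _ (attach e false x) * t e =
      t e * r _ (attach e true x)) ->
  exists (F : {multiplicative pi1 G -> K}) (g : vertex G -> K), [/\ g v0 = 1,
    forall v (a : vgroup v), F (in_vertex a) = g v * r v a * (g v)^-1 &
    forall e, F (stable_letter e) =
              g (endpoint e false) * t e * (g (endpoint e true))^-1].
Proof.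
move=> rD rt; have [g [g0 gT]] := tree_potential t v0.
have [||e Te|F [Fr Ft]] := @pi1_lift G K (fun v a => g v * r v a * (g v)^-1)
    (fun e => g (endpoint e false) * t e * (g (endpoint e true))^-1).
- by move=> v a b; rewrite rD !mulgA mulgVK.
- by move=> e x; rewrite !mulgA !mulgVK -(mulgA _ (r _ _) (t e)) rt !mulgA.
- by rewrite gT // mulgV.
by exists F, g.
Qed.

End TreePaths.

(** * Coordinates in the vertex and edge groups *)

Notation vec := (int * int)%type.

Section Coordinates.
Variable G : tubular_group.
Implicit Types (v w : vertex G) (e : edge G) (x y : vec) (d : dart G).

Lemma vgroup_coord v :
  exists (f : {additive vec -> vgroup v}) (g : vgroup v -> vec),
  cancel f g /\ cancel g f.
Proof. by have [_ /(_ v)[f [g fK gK]] _ _] := splittingP G; exists f, g. Qed.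

Definition of_coord v : {additive vec -> vgroup v} :=
  sval (cid (vgroup_coord v)).
Definition coord v : vgroup v -> vec :=
  sval (cid (svalP (cid (vgroup_coord v)))).

Lemma of_coordK v : cancel (of_coord v) (@coord v).
Proof. exact: proj1 (svalP (cid (svalP (cid (vgroup_coord v))))). Qed.

Lemma coordK v : cancel (@coord v) (of_coord v).
Proof. exact: proj2 (svalP (cid (svalP (cid (vgroup_coord v))))). Qed.

Lemma coordB v : {morph @coord v : a b / (a - b)%R}.
Proof.
by move=> a b; apply: (can_inj (of_coordK v)); rewrite raddfB !coordK.
Qed.

Definition coord_additive v : {additive vgroup v -> vec} :=
  additive_of (@coordB v).

Lemma coordD v : {morph @coord v : a b / (a + b)%R}.
Proof. exact: (raddfD (coord_additive v)). Qed.

Lemma egroup_gen e : exists g : egroup e,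
  (forall z, exists n, z = (g *~ n)%R) /\ injective (intmul g).
Proof.
have [_ _ /(_ e)[f [g fK gK]] _] := splittingP G; exists (f 1%R).
have fz n : f n = (f 1 *~ n)%R by rewrite -raddfMz intz.
by split=> [z|m n]; [exists (g z)|]; rewrite -!fz ?gK // => /(can_inj fK).
Qed.

Definition edge_gen e : egroup e := sval (cid (egroup_gen e)).

Lemma edge_genP e (z : egroup e) : exists n, z = (edge_gen e *~ n)%R.
Proof. by have [] := svalP (cid (egroup_gen e)). Qed.

Lemma edge_gen_inj e : injective (intmul (edge_gen e)).
Proof. by have [] := svalP (cid (egroup_gen e)). Qed.

Definition edge_vec e (b : bool) : vec := coord (attach e b (edge_gen e)).

Lemma of_coord_edge_vec e b n :
  of_coord _ (edge_vec e b *~ n)%R = attach e b (edge_gen e *~ n)%R.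
Proof. by rewrite !raddfMz /= /edge_vec coordK. Qed.

Lemma edge_vec_neq0 e b : edge_vec e b != 0%R.
Proof.
apply/eqP => a0; have := of_coord_edge_vec e b 1; rewrite a0 mul0rz raddf0.
have [_ _ _ inj] := splittingP G; rewrite -(raddf0 (attach e b)) => /(inj e b).
by rewrite mulr1z -(mulr0z (edge_gen e)) -{2}[edge_gen e]mulr1z =>
  /edge_gen_inj.
Qed.

Definition at_vertex v x : pi1 G := in_vertex (of_coord v x).

Lemma in_vertexD v (a b : vgroup v) :
  in_vertex (a + b)%R = in_vertex a * in_vertex b.
Proof.
rewrite /in_vertex /pres_gen pres_classM; apply/esym.
exact/pres_class_eq/pres_rel/pi1_vertex.
Qed.

Lemma in_vertexB v (a b : vgroup v) :
  in_vertex (a - b)%R = in_vertex a * (in_vertex b)^-1.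
Proof. by rewrite -[in RHS](subrK b a) [in RHS]in_vertexD mulgK. Qed.

Lemma at_vertexD v x y : at_vertex v (x + y)%R = at_vertex v x * at_vertex v y.
Proof. by rewrite /at_vertex raddfD in_vertexD. Qed.

Lemma at_vertex0 v : at_vertex v 0%R = 1.
Proof. by apply: (mulgI (at_vertex v 0%R));
  rewrite mulg1 -at_vertexD addr0. Qed.

Lemma at_vertexN v x : at_vertex v (- x)%R = (at_vertex v x)^-1.
Proof. by apply/esym/mulg1_eq; rewrite -at_vertexD addrN at_vertex0. Qed.

Lemma at_vertexB v x y : at_vertex v (x - y)%R = at_vertex v x / at_vertex v y.
Proof. by rewrite at_vertexD at_vertexN. Qed.

Lemma at_vertexMn v x n : at_vertex v (x *+ n)%R = at_vertex v x ^+ n.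
Proof.
by elim: n => [|n IH]; rewrite ?mulr0n ?at_vertex0 // mulrS at_vertexD IH expgS.
Qed.

Lemma at_vertex_comm v x y :
  at_vertex v x * at_vertex v y = at_vertex v y * at_vertex v x.
Proof. by rewrite -!at_vertexD addrC. Qed.

Lemma in_edge_gen e n :
  in_edge (edge_gen e *~ n)%R =
    at_vertex (endpoint e false) (edge_vec e false *~ n)%R.
Proof. by rewrite /at_vertex of_coord_edge_vec. Qed.

Lemma edge_subgroupP e g :
  edge_subgroup e g <->
    exists n, g = at_vertex (endpoint e false) (edge_vec e false *~ n)%R.
Proof.
split=> [[x _ <-]|[n ->]].
  by have [n ->] := edge_genP x; exists n; exact: in_edge_gen.
by exists (edge_gen e *~ n)%R => //; exact: in_edge_gen.
Qed.

Lemma vertex_subgroupP v g : vertex_subgroup v g <->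
    exists x, g = at_vertex v x.
Proof.
by split=> [[a _ <-]|[x ->]]; [exists (coord a); rewrite /at_vertex coordK|
                               exists (of_coord v x)].
Qed.

Definition at_dart d : pi1 G := dart_val (@stable_letter G) d.

Lemma at_dart_rev d : at_dart (dart_rev d) = (at_dart d)^-1.
Proof. by case: d => e []; rewrite /at_dart /dart_val /= ?invgK. Qed.

Lemma stable_letter_tree e : e \in tree G -> stable_letter e = 1.
Proof. by move=> Te; apply/pres_class_eq/pres_rel/pi1_tree. Qed.

Lemma stable_letter_rel e (x : egroup e) :
  in_vertex (attach e false x) * stable_letter e =
  stable_letter e * in_vertex (attach e true x).
Proof.
rewrite /in_vertex /stable_letter /pres_gen !pres_classM.
exact/pres_class_eq/pres_rel/pi1_edge.
Qed.

Lemma at_dart_rel d n :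
  at_dart d * at_vertex (dart_to d) (edge_vec d.1 d.2 *~ n)%R =
  at_vertex (dart_from d) (edge_vec d.1 (~~ d.2) *~ n)%R * at_dart d.
Proof.
case: d => e b; rewrite /at_dart /dart_val /dart_to /dart_from /= /at_vertex.
rewrite !of_coord_edge_vec; have rel := stable_letter_rel (edge_gen e *~ n)%R.
by case: b => //=; apply: (mulgI (stable_letter e));
  rewrite mulVKg mulgA -rel mulgK.
Qed.

(** * Reduced paths *)

Definition path_val (p : seq (vec * dart G)) : pi1 G :=
  \prod_(x <- p) (at_vertex (dart_from x.2) x.1 * at_dart x.2).

Lemma path_val_cons x d p :
  path_val ((x, d) :: p) = at_vertex (dart_from d) x * at_dart d * path_val p.
Proof. by rewrite /path_val big_cons. Qed.

Definition reduced_expr v w g : Prop := exists p c, [/\ walk v (unzip2 p) w,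
  reduced_path edge_vec p & g = path_val p * at_vertex w c].

Lemma reduced_expr_vertex v w x g :
  reduced_expr v w g -> reduced_expr v w (at_vertex v x * g).
Proof.
case=> [[|[y d] p] [c [/= walk_p red_p ->]]].
  move/eqP: (walk_p) => eq_vw; exists [::], (x + c)%R; split=> //.
  by rewrite /path_val big_nil !mul1g at_vertexD eq_vw.
move/andP: (walk_p) => [/eqP eq_v _]; exists (((x + y)%R, d) :: p), c;
  split=> //.
  by case: p red_p {walk_p} => [//|[z d'] p] /=.
by rewrite !path_val_cons at_vertexD -eq_v !mulgA.
Qed.

(** Prepending a dart either gives a reduced path or undoes the first dart. *)
Lemma reduced_expr_dart d w g :
  reduced_expr (dart_to d) w g -> reduced_expr (dart_from d) w (at_dart d * g).
Proof.
case=> p [c [walk_p red_p ->]].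
have [red|] := boolP (reduced_path edge_vec ((0%R, d) :: p)).
  exists ((0%R, d) :: p), c; split=> //=; first by rewrite eqxx.
  by rewrite path_val_cons at_vertex0 mul1g mulgA.
case: p walk_p red_p => [//|[x d'] p] /= /andP[_ walk_p] red_p.
rewrite /reduced_path /= -/(reduced_path _ _) negb_and [path _ _ _]red_p orbF.
move=> /asboolPn/not_implyP[/= def_d' /contrapT[k /= def_x]].
have {}def_d' : d' = dart_rev d by [].
have -> : at_dart d * (path_val ((x, d') :: p) * at_vertex w c) =
    at_vertex (dart_from d) (edge_vec d.1 (~~ d.2) *~ k)%R *
    (path_val p * at_vertex w c).
  rewrite path_val_cons def_x def_d' dart_from_rev at_dart_rev /= negbK !mulgA.
  by rewrite at_dart_rel mulgK.
apply: reduced_expr_vertex; exists p, c; split=> //;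
  last exact: path_sorted red_p.
by rewrite -[d]dart_revK dart_from_rev -def_d'.
Qed.

Lemma reduced_expr_tree v v' w g : reduced_expr v' w g -> reduced_expr v w g.
Proof.
have [_ /(_ v v')[p [[walk_p _ Tp] _]]] := treeP G.
elim: p v walk_p Tp => [|d p IH] v /=; first by move/eqP->.
case/andP=> /eqP <- walk_p /andP[Td Tp] /(IH _ walk_p Tp) /reduced_expr_dart.
by rewrite /at_dart /dart_val stable_letter_tree // invg1; case: ifP;
  rewrite mul1g.
Qed.

(** As the letters of the spanning tree are trivial, an element has a reduced
    expression along a path between any two vertices. *)
Lemma exists_reduced_expr v w g : reduced_expr v w g.
Proof.
elim/presented_ind: g v => [|x g IH|x g IH] v.
- apply: (@reduced_expr_tree v w); exists [::], 0%R; split=> //=.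
  by rewrite /path_val big_nil at_vertex0 mul1g.
- case: x => [[u a]|e].
    rewrite -[pres_gen _ _]/(in_vertex a) -[a]coordK.
    rewrite -[in_vertex _]/(at_vertex _ _).
    exact/(@reduced_expr_tree v u)/reduced_expr_vertex.
  by apply: (@reduced_expr_tree v (dart_from (e, true)));
    exact: (@reduced_expr_dart (e, true)).
- case: x => [[u a]|e].
    rewrite -[pres_gen _ _]/(in_vertex a) -[a]coordK.
    rewrite -[in_vertex _]/(at_vertex _ _).
    by rewrite -at_vertexN; exact/(@reduced_expr_tree v u)/reduced_expr_vertex.
  by apply: (@reduced_expr_tree v (dart_from (e, false)));
    exact: (@reduced_expr_dart (e, false)).
Qed.

Lemma pi1_ind (P : pi1 G -> Prop) :
    P 1 -> (forall v x g, P g -> P (at_vertex v x * g)) ->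
    (forall d g, P g -> P (at_dart d * g)) ->
  forall g, P g.
Proof.
move=> P1 Pv Pd g; have [[[v _] _] _ _ _] := splittingP G.
have [p [c [_ _ ->]]] := exists_reduced_expr v v g.
elim: p {g} => [|[x d] p IH].
  by rewrite /path_val big_nil mul1g -[at_vertex _ _]mulg1; exact: Pv.
by rewrite path_val_cons -!mulgA; apply/Pv/Pd.
Qed.

End Coordinates.

(** * Representations by affine permutations *)

Section Unimodular.
Variable R : comNzRingType.
Implicit Types (x y z : (R * R)%type).

Definition unimodular x : Prop := exists y, (y.1 * x.1 + y.2 * x.2 = 1)%R.

Definition vscale (m : R) x : (R * R)%type := (m * x.1, m * x.2)%R.

Lemma vscaleMz m x k : (vscale m x *~ k)%R = vscale (m *~ k)%R x.
Proof.
suff nat_case n : (vscale m x *+ n)%R = vscale (m *+ n)%R x.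
  case: k => n; first exact: nat_case.
  by rewrite !NegzE !mulrNz -!pmulrn nat_case /vscale; congr pair;
    rewrite /= mulNr.
elim: n => [|n IH]; first by rewrite !mulr0n /vscale !mul0r.
by rewrite !mulrS IH /vscale; congr pair; rewrite /= mulrDl.
Qed.

(** A unimodular vector is the first column of a matrix of determinant 1, so
    that each is carried to any other by an automorphism of the plane. *)
Lemma unimodular_transitive x y : unimodular x -> unimodular y ->
  exists t : permutation (R * R)%type, forall m k z,
    (t (z + vscale m x *~ k) = t z + vscale m y *~ k)%R.
Proof.
case: x y => [x1 x2] [y1 y2] [[u1 u2] /= ux] [[w1 w2] /= wy].
(* The product of the matrix with first column y and determinant 1 by the
   inverse of the one with first column x. *)
pose f (a b c d : R) (z : R * R) : R * R :=
  (a * z.1 + b * z.2, c * z.1 + d * z.2)%R.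
pose t := f (y1 * u1 + w2 * x2)%R (y1 * u2 - w2 * x1)%R
            (y2 * u1 - w1 * x2)%R (y2 * u2 + w1 * x1)%R.
pose t' := f (x1 * w1 + u2 * y2)%R (x1 * w2 - u2 * y1)%R
            (x2 * w1 - u1 * y2)%R (x2 * w2 + u1 * y1)%R.
have tK : cancel t t'.
  case=> z1 z2; rewrite /t /t' /f /=; congr pair.
    transitivity ((u1 * x1 + u2 * x2) * (w1 * y1 + w2 * y2) * z1)%R;
      first by ring.
    by rewrite ux wy !mul1r.
  transitivity ((u1 * x1 + u2 * x2) * (w1 * y1 + w2 * y2) * z2)%R;
    first by ring.
  by rewrite ux wy !mul1r.
have t'K : cancel t' t.
  case=> z1 z2; rewrite /t /t' /f /=; congr pair.
    transitivity ((u1 * x1 + u2 * x2) * (w1 * y1 + w2 * y2) * z1)%R;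
      first by ring.
    by rewrite ux wy !mul1r.
  transitivity ((u1 * x1 + u2 * x2) * (w1 * y1 + w2 * y2) * z2)%R;
    first by ring.
  by rewrite ux wy !mul1r.
exists (Permutation tK t'K) => m k [z1 z2]; rewrite !vscaleMz /= /t /f /=.
move: (m *~ k)%R => n; congr pair.
  transitivity (y1 * u1 * z1 + w2 * x2 * z1 + (y1 * u2 - w2 * x1) * z2 +
    n * y1 * (u1 * x1 + u2 * x2))%R; first by ring.
  by rewrite ux /=; ring.
transitivity (y2 * u1 * z1 - w1 * x2 * z1 + (y2 * u2 + w1 * x1) * z2 +
    n * y2 * (u1 * x1 + u2 * x2))%R; first by ring.
by rewrite ux /=; ring.
Qed.

End Unimodular.

Section AffineRepresentation.
Variables (G : tubular_group) (R : comNzRingType).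
Variables (f : forall v : vertex G, {additive vec -> (R * R)%type}).
Variables (m : edge G -> R) (u : edge G -> bool -> (R * R)%type).
Hypothesis uU : forall e b, unimodular (u e b).
Hypothesis fE :
  forall e b, f (endpoint e b) (edge_vec e b) = vscale (m e) (u e b).

Definition path_image (p : seq (vec * dart G)) :=
  [seq (f (dart_from x.2) x.1, x.2) | x <- p].

(** The vertex groups act on copies of the plane over R by translations, and
    the stable letters preserve the copies up to finitely many exchanges. *)
Lemma affine_representation (v0 : vertex G) p c :
    walk v0 (unzip2 p) v0 ->
    reduced_path (fun e b => vscale (m e) (u e b)) (path_image p) ->
  exists (F : {multiplicative pi1 G ->
    permutation ((R * R) * 'I_(size p).+1)%type})
         (g : vertex G -> permutation ((R * R) * 'I_(size p).+1)%type),
    [/\ g v0 = 1,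
        forall v x, F (at_vertex v x) =
          g v * translation 'I_(size p).+1 (f v x) * (g v)^-1 &
        exists z, F (path_val p * at_vertex v0 c) (0%R, ord0) = (z, ord_max)].
Proof.
move=> walk_p red_p.
pose a e b := vscale (m e) (u e b).
have exT0 e := unimodular_transitive (uU e true) (uU e false).
have [||t [eq_t move_t]] := @reduced_path_permutation (edge G) (R * R)%type a
  (f v0 c) (size p) (fun e => sval (cid (exT0 e))) (path_image p) _ _ red_p.
- by move=> e k x; exact: (svalP (cid (exT0 e))).
- by rewrite size_map.
have [||F [g [g0 Fv Fe]]] := @pi1_lift_conj G _
    (fun v (b : vgroup v) => translation 'I_(size p).+1 (f v (coord b))) t v0.
- by move=> v x y; rewrite coordD raddfD translationD.
- move=> e z; have [n ->] := edge_genP z; apply: eq_permutation => s.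
  rewrite -!of_coord_edge_vec !of_coordK !(raddfMz (f _)) !fE !permM.
  by have := eq_t e n s; rewrite /a.
exists F, g; split=> // [v x|]; first by rewrite Fv of_coordK.
have Fd d : F (at_dart d) =
    g (dart_from d) * dart_perm t d * (g (dart_to d))^-1.
  case: d => e []; rewrite /at_dart /dart_val /dart_perm /dart_from /dart_to /=.
    exact: Fe.
  by rewrite multV Fe !invgM invgK mulgA.
suff FE q w : walk w (unzip2 q) v0 -> F (path_val q * at_vertex v0 c) =
    g w * (path_perm t (path_image q) * translation _ (f v0 c)) * (g v0)^-1.
  by rewrite (FE p v0) // g0 invg1 mulg1 mul1g move_t; eexists.
elim: q w => [|[x d] q IH] w /=.
  by move/eqP->; rewrite /path_val /path_perm !big_nil !mul1g Fv of_coordK.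
case/andP => /eqP <- /IH {}IH; rewrite path_val_cons -mulgA gmulfM IH.
rewrite [in RHS]/path_perm big_cons -/(path_perm _ _) gmulfM Fv of_coordK Fd.
by rewrite !mulgA !mulgVK.
Qed.

End AffineRepresentation.

(** * Integers and integer vectors *)

Lemma zsubgroupN (A : zmodType) (S : set A) x : zsubgroup S -> S x -> S (- x)%R.
Proof. by move=> [S0 SB] Sx; rewrite -sub0r; apply: SB. Qed.

Lemma zsubgroupD (A : zmodType) (S : set A) x y : zsubgroup S -> S x -> S y ->
  S (x + y)%R.
Proof.
by move=> sS Sx Sy; rewrite -[y]opprK; apply: sS.2 => //; apply: zsubgroupN.
Qed.

Lemma zsubgroupMz (A : zmodType) (S : set A) x n : zsubgroup S -> S x ->
  S (x *~ n)%R.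
Proof.
move=> sS Sx; suff nat_case (k : nat) : S (x *+ k)%R.
  case: n => k; first exact: nat_case.
  by rewrite NegzE mulrNz; apply: zsubgroupN sS (nat_case _).
by elim: k => [|k IH]; [exact: sS.1|rewrite mulrS; apply: zsubgroupD].
Qed.

Lemma int_subgroup_principal (S : set int) : zsubgroup S ->
  exists2 a, S a & forall x, S x -> (a %| x)%Z.
Proof.
move=> sS; have [[a [Sa a0]]|S0] := pselect (exists a, S a /\ a != 0%R);
  last first.
  exists 0%R; first exact: sS.1.
  move=> x Sx; rewrite dvd0z; apply/negPn/negP => x0; apply: S0.
  by exists x; split=> //.
have exk : exists k, (0 < k)%N && `[< S k%:Z%R >].
  exists `|a|%N; rewrite absz_gt0 a0; apply/asboolP.
  by rewrite abszE; case: (ger0P a) => _ //; exact: zsubgroupN.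
case: (ex_minnP exk) => k /andP[k0 /asboolP Sk] kmin.
exists k%:Z%R => // x Sx; apply/dvdz_mod0P/eqP; apply: contraT => r0.
have kz0 : (k%:Z != 0)%R by rewrite eqz_nat -lt0n.
have r_ge0 : (0 <= (x %% k)%Z)%R by rewrite modz_ge0.
have : (`|(x %% k)%Z| < k)%N
    by rewrite -ltz_nat abszE ger0_norm ?ltz_pmod // ltz_nat.
rewrite ltnNge kmin // absz_gt0 r0; apply/asboolP; rewrite abszE ger0_norm //.
have -> : (x %% k)%Z = (x - k%:Z *~ (x %/ k)%Z)%R.
  by rewrite mulrzz {2}(divz_eq x k) mulrC addrC addKr.
by apply: sS.2 => //; apply: zsubgroupMz.
Qed.

Section Vectors.
Implicit Types (x y a u : vec).

Lemma vecMz x n : (x *~ n)%R = (x.1 * n, x.2 * n)%R.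
Proof.
suff nat_case (k : nat) : (x *+ k)%R = (x.1 * k%:Z, x.2 * k%:Z)%R.
  case: n => k; first exact: nat_case.
  by rewrite !NegzE !mulrNz -!pmulrn nat_case !mulrN.
case: x => x1 x2; elim: k => [|k IH]; first by rewrite mulr0n !mulr0.
by rewrite mulrS IH; congr pair; rewrite /= intS mulrDr mulr1.
Qed.

Lemma vec_torsionfree x n : (x *~ n)%R = 0%R -> n != 0%R -> x = 0%R.
Proof.
case: x => x1 x2; rewrite vecMz => -[/eqP x1n /eqP x2n] n0.
by move: x1n x2n; rewrite !mulf_eq0 (negbTE n0) !orbF => /eqP-> /eqP->.
Qed.

Lemma vecMzI n : n != 0%R -> injective (fun x => (x *~ n)%R).
Proof.
move=> n0 x y /eqP;
  rewrite -subr_eq0 -mulrzBl => /eqP /vec_torsionfree/(_ n0)/eqP.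
by rewrite subr_eq0 => /eqP.
Qed.

Lemma vec_mulz_inj a : a != 0%R -> injective (intmul a).
Proof.
move=> a0 m n /eqP; rewrite -subr_eq0 -mulrzBr => /eqP amn.
by apply/eqP; rewrite -subr_eq0; apply: contraT => /(vec_torsionfree amn)/eqP;
  rewrite (negbTE a0).
Qed.

Lemma unimodular_neq0 u : unimodular u -> u != 0%R.
Proof. by case=> y uy; apply/eqP => u0; move: uy;
  rewrite u0 /= !mulr0 addr0. Qed.

Lemma unimodular_div u x j k : unimodular u -> j != 0%R ->
  (x *~ j = u *~ k)%R -> exists i, x = (u *~ i)%R /\ k = (i * j)%R.
Proof.
move=> uU j0 xj; have [y uy] := uU.
have def_k : k = ((y.1 * x.1 + y.2 * x.2) * j)%R.
  move: xj; rewrite !vecMz => -[x1 x2].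
  by rewrite mulrDl -!mulrA x1 x2 !mulrA -mulrDl uy mul1r.
exists (y.1 * x.1 + y.2 * x.2)%R; split=> //.
by apply: (vecMzI j0); rewrite /= xj -mulrzA -def_k.
Qed.

Lemma exists_unimodular a : a != 0%R ->
  exists u m, [/\ unimodular u, m != 0%R & a = (u *~ m)%R].
Proof.
case: a => a1 a2 a0; pose m := gcdz a1 a2.
have m0 : m != 0%R.
  by rewrite gcdz_eq0; apply: contra a0 => /andP[/eqP-> /eqP->].
have [y1 [y2 bez]] := Bezoutz a1 a2.
have a1E : a1 = ((a1 %/ m)%Z * m)%R by rewrite divzK // dvdz_gcdl.
have a2E : a2 = ((a2 %/ m)%Z * m)%R by rewrite divzK // dvdz_gcdr.
exists ((a1 %/ m)%Z, (a2 %/ m)%Z), m; split=> //;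
  last by rewrite vecMz /= -a1E -a2E.
exists (y1, y2); apply: (mulIf m0); rewrite mul1r mulrDl -!mulrA -a1E -a2E.
exact: bez.
Qed.

Lemma noncyclic a : exists b, forall k, b <> (a *~ k)%R.
Proof.
apply: contrapT => /forallNP h.
have cyc b : exists k, b = (a *~ k)%R by have /existsNP[k /contrapT ?] := h b;
  exists k.
have [k] := cyc (1, 0)%R; have [l] := cyc (0, 1)%R.
rewrite !vecMz => -[_ a2l] [a1k /esym/eqP]; rewrite mulf_eq0 => /orP[] /eqP e0.
  by move: a2l; rewrite e0 mul0r.
by move: a1k; rewrite e0 mulr0.
Qed.

Lemma maximal_cyclic_unimodular u : unimodular u ->
  maximal_cyclic (cyclic_subgroup u).
Proof.
move=> uU; split=> [|b sub]; first by exists u.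
have [k _ ub] : cyclic_subgroup b u by apply: sub; exists 1%R.
have k0 : k != 0%R.
  by apply: contraTneq (unimodular_neq0 uU) => k0; rewrite -ub k0 mulr0z eqxx.
apply/seteqP; split=> // _ [i _ <-].
have [|j [-> _]] := @unimodular_div u b k 1%R uU k0; first by rewrite ub mulr1z.
by exists (j * i)%R; rewrite ?mulrzA.
Qed.

Definition vec_cast (R : comNzRingType) x : (R * R)%type :=
  (x.1%:~R, x.2%:~R)%R.

Lemma vec_castB (R : comNzRingType) : {morph vec_cast R : x y / (x - y)%R}.
Proof. by move=> x y; rewrite /vec_cast /= !rmorphB. Qed.

Definition vec_cast_additive (R : comNzRingType) :
  {additive vec -> (R * R)%type} := additive_of (@vec_castB R).

Lemma vec_cast_scale (R : comNzRingType) m u :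
  vec_cast R (u *~ m)%R = vscale m%:~R%R (vec_cast R u).
Proof. by rewrite vecMz /vec_cast /vscale /= !rmorphM /= !(mulrC m%:~R%R). Qed.

Lemma vec_cast_unimodular (R : comNzRingType) u : unimodular u ->
  unimodular (vec_cast R u).
Proof.
case=> y uy; exists (vec_cast R y); rewrite /vec_cast /=.
by rewrite -!rmorphM -rmorphD /= uy.
Qed.

Lemma Zp_intr_eq0 (n : nat) (z : int) : (1 < n)%N ->
  (z%:~R == 0 :> 'Z_n)%R = (n%:Z %| z)%Z.
Proof.
move=> n1; rewrite /dvdz absz_nat.
suff nat_case (k : nat) : (k%:R == 0 :> 'Z_n)%R = (n %| k).
  case: z => k; first exact: nat_case.
  by rewrite NegzE rmorphN /= oppr_eq0 nat_case.
by rewrite -val_eqE /= val_Zp_nat.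
Qed.

Lemma vec_cast_eq0 (n : nat) x : (1 < n)%N ->
  vec_cast 'Z_n x = 0%R <-> exists y, x = (y *~ n)%R.
Proof.
move=> n1; split=> [[/eqP + /eqP]|[y ->]].
  rewrite !Zp_intr_eq0 // => /dvdzP[y1 x1] /dvdzP[y2 x2].
  by exists (y1, y2); rewrite vecMz; case: x x1 x2 => /= ? ? -> ->.
rewrite vec_cast_scale /vscale /= (eqP (_ : n%:~R == 0)%R) ?mul0r //.
by rewrite Zp_intr_eq0.
Qed.

(** A line spanned by a multiple of a unimodular vector is closed in the
    profinite topology; the congruence works for all multiples of a modulus. *)
Lemma line_separated u m x : unimodular u -> m != 0%R ->
  (forall k, x <> (u *~ (m * k))%R) ->
  exists2 n1 : nat, (0 < n1)%N & forall n k y, (n1 %| n) ->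
    (x <> u *~ (m * k) + y *~ n)%R.
Proof.
case: u => u1 u2; case: x => x1 x2 [[v1 v2] /= uv] m0 nx.
(* The determinant with u and, when that vanishes, the coordinate along u. *)
pose del := (u1 * x2 - u2 * x1)%R; pose bet := (v1 * x1 + v2 * x2)%R.
have [del0|del_neq0] := eqVneq del 0%R; last first.
  (* The factor 2 keeps the modulus from dividing the determinant. *)
  exists `|(2 * del)%R|%N; first by rewrite absz_gt0 mulf_neq0.
  move=> n k [y1 y2] /dvdnP[q def_n]; rewrite !vecMz => -[e1 e2].
  have /(congr1 absz) : del = ((u1 * y2 - u2 * y1) * n%:Z)%R.
    by rewrite /del e1 e2; ring.
  move: del_neq0; rewrite def_n -absz_eq0 !abszM absz_nat (mulnCA _ 2) -/del.
  move: `|del|%N `|_|%N => D M D0 /eqP.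
  rewrite !mulnA -[X in X == _]mul1n eqn_pmul2r ?lt0n // => /eqP.
  by move=> /(congr1 odd); rewrite !oddM /= andbF.
exists `|m|%N; first by rewrite absz_gt0.
move=> n k [y1 y2] /dvdnP[q def_n]; rewrite !vecMz => -[e1 e2].
have n_m : (n%:Z = q%:Z * sgz m * m)%R
    by rewrite def_n PoszM abszE -mulrA normrEsg sgrz.
have x_bet : (x1, x2) = (u1 * bet, u2 * bet)%R.
  have eq12 : (u1 * x2 = u2 * x1)%R by apply/eqP; rewrite -subr_eq0 -/del del0.
  congr pair; rewrite /bet.
    transitivity ((v1 * u1 + v2 * u2) * x1)%R; first by rewrite uv mul1r.
    by rewrite mulrDl -[X in (_ + X)%R]mulrA -eq12; ring.
  transitivity ((v1 * u1 + v2 * u2) * x2)%R; first by rewrite uv mul1r.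
  by rewrite mulrDl -[X in (X + _)%R]mulrA eq12; ring.
apply: (nx (k + (v1 * y1 + v2 * y2) * (q%:Z * sgz m))%R); rewrite vecMz x_bet.
suff -> : bet = (m * (k + (v1 * y1 + v2 * y2) * (q%:Z * sgz m)))%R by [].
rewrite /bet e1 e2 /= n_m.
transitivity ((v1 * u1 + v2 * u2) * (m * k) + (v1 * y1 + v2 * y2)
  * (q%:Z * sgz m * m))%R.
  by ring.
by rewrite uv; ring.
Qed.

End Vectors.

(** * Vertex groups and reduced paths in the fundamental group *)

Lemma unimodular_field (F : fieldType) (x : F * F) : x != 0%R -> unimodular x.
Proof.
case: x => x1 x2 x0; have [x1_0|x1_neq0] := eqVneq x1 0%R; last first.
  by exists (x1^-1, 0)%R; rewrite /= mulVf // mul0r addr0.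
exists (0, x2^-1)%R; rewrite /= mul0r add0r mulVf //.
by apply: contra x0 => /eqP ->; rewrite x1_0.
Qed.

Section Faithful.
Variable G : tubular_group.
Implicit Types (v : vertex G) (e : edge G) (x a : vec).

Lemma path_image_reduced (R : comNzRingType) (f :
    forall v, {additive vec -> (R * R)%type})
    (a : edge G -> bool -> (R * R)%type) (p : seq (vec * dart G)) :
    (forall x d, (x, d) \in p ->
      (exists k, f (dart_from d) x = (a d.1 (~~ d.2) *~ k)%R) ->
      exists k, x = (edge_vec d.1 (~~ d.2) *~ k)%R) ->
  reduced_path (@edge_vec G) p -> reduced_path a (path_image f p).
Proof.
move=> fP; rewrite /reduced_path sorted_map.
apply: (@sub_in_sorted _ (mem p)); last by apply/allP.
move=> [x d] [y d'] px py /asboolP /= np; apply/asboolP => /= eq_d.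
by move=> /(fP _ _ py); exact: np.
Qed.

Let rat_vec (v : vertex G) := vec_cast_additive rat.

Lemma rat_vec_inj v : injective (rat_vec v).
Proof. by case=> x1 x2 [y1 y2] [/intr_inj-> /intr_inj->]. Qed.

Lemma rat_edge_vecE e b :
  rat_vec (endpoint e b) (edge_vec e b) =
    vscale 1%R (vec_cast rat (edge_vec e b)).
Proof. by rewrite /vscale !mul1r. Qed.

Lemma rat_edge_vec_unimodular e b : unimodular (vec_cast rat (edge_vec e b)).
Proof.
apply: unimodular_field; apply: contra (edge_vec_neq0 e b) => /eqP a0.
by apply/eqP/(@rat_vec_inj (endpoint e b)); rewrite raddf0.
Qed.

Let rat_representation :=
  affine_representation rat_edge_vec_unimodular rat_edge_vecE.

(** The vertex groups act faithfully by translations of the rational plane. *)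
Lemma at_vertex_inj v : injective (at_vertex v).
Proof.
move=> x y xy; have [F [g [_ Fv _]]] :=
  @rat_representation v [::] 0%R (eqxx v) isT.
have := Fv v x; rewrite xy Fv => /mulIg/mulgI.
move/(congr1 (fun s : permutation _ => (s (0%R, ord0)).1)) => /=.
by rewrite !add0r => /esym/(@rat_vec_inj v).
Qed.

Lemma reduced_path_neq1 v p c : walk v (unzip2 p) v ->
  reduced_path (@edge_vec G) p -> p != [::] -> path_val p * at_vertex v c != 1.
Proof.
move=> walk_p red_p p0; apply/eqP => val1.
have red_p' : reduced_path (fun e b => vscale 1%R (vec_cast rat (edge_vec e b)))
                           (path_image rat_vec p).
  apply: path_image_reduced red_p => x d _ [k fx]; exists k.
  apply: (@rat_vec_inj (dart_from d)); rewrite fx raddfMz.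
  by rewrite /dart_from -rat_edge_vecE.
have [F [g [_ _ [z]]]] := @rat_representation v p c walk_p red_p'.
rewrite val1 mult1 => /(congr1 (fun s => val s.2)) /= sz_p.
by case: p p0 sz_p {walk_p red_p red_p' val1 F g z}.
Qed.

(** On both sides of an edge, elements outside the edge group do not commute:
    their commutator is a reduced path of length 4. *)
Lemma across_edge_commutator (d : dart G) a x :
    (forall k, a <> (edge_vec d.1 (~~ d.2) *~ k)%R) ->
    (forall k, x <> (edge_vec d.1 d.2 *~ k)%R) ->
  let y := at_dart d * at_vertex (dart_to d) x * (at_dart d)^-1 in
  at_vertex (dart_from d) a * y * (at_vertex (dart_from d) a)^-1 * y^-1 <> 1.
Proof.
move=> na nx y; pose d' := dart_rev d.
have nNa k : (- a)%R <> (edge_vec d.1 (~~ d.2) *~ k)%R.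
  by move=> aE; apply: (na (- k)%R); rewrite mulrNz -aE opprK.
have nNx k : (- x)%R <> (edge_vec d.1 d.2 *~ k)%R.
  by move=> xE; apply: (nx (- k)%R); rewrite mulrNz -xE opprK.
pose p := [:: (a, d); (x, d'); ((- a)%R, d); ((- x)%R, d')].
have walk_p : walk (dart_from d) (unzip2 p) (dart_from d).
  by rewrite /= dart_from_rev /d' -[dart_to (dart_rev d)]dart_from_rev
    dart_revK !eqxx.
have red_p : reduced_path (@edge_vec G) p.
  apply/and4P; split=> //; apply/asboolP => _ [k] /=; rewrite ?negbK => xE.
  - exact: (nx k).
  - exact: (nNa k).
  - exact: (nNx k).
apply/eqP; rewrite -[X in X == _]mulg1
  -[X in _ * X == _](at_vertex0 (dart_from d)).
have -> : at_vertex (dart_from d) a * y * (at_vertex (dart_from d) a)^-1 * y^-1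
    = path_val p.
  rewrite !path_val_cons /path_val big_nil mulg1 dart_from_rev at_dart_rev
    !at_vertexN.
  by rewrite /y !invgM invgK !mulgA.
exact: reduced_path_neq1.
Qed.

(** In the Bass-Serre tree, the end b of the edge stabilised by the subgroup of
    e is the translate of a base vertex by this element. *)
Definition edge_end e (b : bool) : pi1 G := if b then stable_letter e else 1.

Definition conj_end e b (g : pi1 G) := edge_end e b * g * (edge_end e b)^-1.

Lemma conj_endM e b : {morph conj_end e b : x y / x * y}.
Proof. by move=> x y; rewrite /conj_end !mulgA mulgVK. Qed.

Lemma conj_end_edge_vec e b n :
  conj_end e b (at_vertex (endpoint e b) (edge_vec e b *~ n)%R) =
  at_vertex (endpoint e false) (edge_vec e false *~ n)%R.
Proof.
rewrite /conj_end /edge_end; case: b; last by rewrite invg1 mulg1 mul1g.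
by have /= -> := at_dart_rel (e, true) n; rewrite mulgK.
Qed.

Lemma conj_end_edge e b x :
  edge_subgroup e (conj_end e b (at_vertex (endpoint e b) x)) <->
  exists k, x = (edge_vec e b *~ k)%R.
Proof.
rewrite edge_subgroupP; split=> -[k].
  by rewrite -(conj_end_edge_vec e b) => /mulIg/mulgI/at_vertex_inj ->;
    exists k.
by move=> ->; exists k; rewrite conj_end_edge_vec.
Qed.

Lemma conj_end_normal (N : set (pi1 G)) e b g :
  normal_subgroup N -> N (conj_end e b g) <-> N g.
Proof. by move=> nN; exact: normalJ. Qed.

End Faithful.

(** * Isolating the edge groups *)

Lemma edge_generator (G : tubular_group) (e : edge G) (g : egroup e) :
    cyclic_subgroup g = [set: egroup e] ->
  exists s t, (s * t = 1)%R /\ g = (edge_gen e *~ s)%R.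
Proof.
move=> gen_g; have [s gs] := edge_genP g.
have [t _ gt] : cyclic_subgroup g (edge_gen e) by rewrite gen_g.
by exists s, t; split=> //; apply: (@edge_gen_inj G e);
  rewrite mulr1z -[RHS]gt gs mulrzA.
Qed.

Lemma edge_gen_unit (G : tubular_group) (e : edge G) s t : (s * t = 1)%R ->
  forall z : egroup e, exists k, z = (edge_gen e *~ s *~ k)%R.
Proof.
move=> st z; have [n ->] := edge_genP z; exists (t * n)%R.
by rewrite -mulrzA mulrA st mul1r.
Qed.

Lemma edge_gen_unit_neq0 (G : tubular_group) (e : edge G) s t : (s * t = 1)%R ->
  (edge_gen e *~ s)%R <> 0%R.
Proof.
move=> st; rewrite -(mulr0z (edge_gen e)) => /edge_gen_inj s0.
by move: st; rewrite s0 mul0r.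
Qed.

Section Isolation.
Variable G : tubular_group.
Implicit Types (v : vertex G) (e : edge G) (x a : vec) (N : set (pi1 G)).

(** The property through which residual finiteness, virtual primitivity and
    separability of the edge groups all yield regulating tuples: each coset of
    the edge group in its root closure in a vertex group, other than the edge
    group, avoids some normal subgroup of finite index. *)
Definition edges_isolable : Prop := forall e b a,
  (forall k, a <> (edge_vec e b *~ k)%R) ->
  (exists j k, j != 0%R /\ (a *~ j)%R = (edge_vec e b *~ k)%R) ->
  exists N, [/\ normal_subgroup N, finite_index N &
    forall k, ~ N (at_vertex (endpoint e b) (a + edge_vec e b *~ k)%R)].

Lemma residually_finite_isolable : residually_finite (pi1 G) -> edges_isolable.
Proof.
move=> rf e b a na _; have [x nx] := noncyclic (edge_vec e (~~ b)).
pose d : dart G := (e, ~~ b).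
have [|N [nN fN nNc]] := rf _ (@across_edge_commutator G d a x _ nx).
  by rewrite /= negbK.
exists N; split=> // k Nak; apply: nNc; move: Nak; rewrite /dart_from /= negbK.
set v := endpoint e b; set y := (X in at_vertex v a * X);
  set z := (edge_vec e b *~ k)%R.
have zy : at_vertex v z * y = y * at_vertex v z.
  have := at_dart_rel d k; rewrite /dart_from /= negbK -/v -/z => rel.
  rewrite /y !mulgA -rel -[LHS]mulgA -[RHS]mulgA.
  have -> : (at_dart d)^-1 * at_vertex v z =
            at_vertex (dart_to d) (edge_vec e (~~ b) *~ k)%R * (at_dart d)^-1.
    by apply: (mulgI (at_dart d)); rewrite mulVKg mulgA rel mulgK.
  by rewrite !mulgA -[_ * _ * at_vertex _ x]mulgA at_vertex_comm !mulgA.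
move=> Nw; set w := at_vertex v (a + z)%R in Nw.
have -> : at_vertex v a * y * (at_vertex v a)^-1 * y^-1 = w * (y * w^-1 * y^-1).
  rewrite /w at_vertexD; move: (at_vertex v a) (at_vertex v z) y zy => A Z Y ZY.
  rewrite invgM !mulgA -(mulgA _ _ Y) ZY !mulgA.
  by rewrite -(mulgA _ Z) mulgV mulg1.
by apply: (subgroupM nN.1 Nw); apply: nN.2; exact: subgroupV nN.1 Nw.
Qed.

Lemma separable_isolable : separable_edge_groups G -> edges_isolable.
Proof.
move=> sep e b a na _; pose g := conj_end e b (at_vertex (endpoint e b) a).
have [Fam [FamP GeE]] := sep e.
have nge : ~ edge_subgroup e g by move/conj_end_edge => [k /na].
have [K FK nKg] : exists2 K, Fam K & ~ K g.
  apply: contrapT => /forall2NP nK; apply: nge; rewrite GeE => K FK.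
  by have [//|/contrapT] := nK K.
have [N [nN fN subNK]] := exists_normal_core (FamP K FK).
have [sK _] := FamP K FK.
exists N; split=> // k; rewrite -(conj_end_normal e b _ nN) => /subNK.
rewrite at_vertexD conj_endM conj_end_edge_vec => Kgz; apply: nKg.
rewrite -[g](mulgK (at_vertex (endpoint e false) (edge_vec e false *~ k)%R)).
apply: sK.2 => //;
  have : edge_subgroup e
  (at_vertex (endpoint e false) (edge_vec e false *~ k)%R).
  by apply/edge_subgroupP; exists k.
by rewrite GeE; apply.
Qed.

Definition isolates N e b : Prop := forall x,
  (exists j k, j != 0%R /\ (x *~ j)%R = (edge_vec e b *~ k)%R) ->
  N (at_vertex (endpoint e b) x) -> exists k, x = (edge_vec e b *~ k)%R.

(** The root closure of the edge group is cyclic, hence the edge group has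
    finitely many cosets in it. *)
Lemma isolable_edge_end e b : edges_isolable ->
  exists N, [/\ normal_subgroup N, finite_index N & isolates N e b].
Proof.
move=> iso; have [u [m [uU m0 aE]]] := exists_unimodular (edge_vec_neq0 e b).
pose P (i : 'I_`|m|) N := (forall k, (u *~ i%:Z)%R <> (edge_vec e b *~ k)%R) ->
  forall k, ~ N (at_vertex (endpoint e b) (u *~ i%:Z + edge_vec e b *~ k)%R).
have [|i|N [nN fN NP]] := @finite_index_bigI _ _ P.
- by move=> i N M PN subMN ni k /subMN; exact: PN.
- have [[k ui]|/forallNP ni] :=
    pselect (exists k, (u *~ i%:Z)%R = (edge_vec e b *~ k)%R).
    exists [set: pi1 G]; split; [exact: normal_setT|exact: finite_index_setT|].
    by move=> /(_ k).
  have [|N [nN fN NP]] := iso e b (u *~ i%:Z)%R ni.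
    by exists m, (i%:Z)%R; split=> //; rewrite aE -!mulrzA mulrC.
  by exists N; split.
exists N; split=> // x [j [k [j0 xj]]] Nx; apply: contrapT => /forallNP nx.
have [|l [def_x _]] := @unimodular_div u x j (m * k)%R uU j0.
  by rewrite xj aE -mulrzA.
have lti : (`|(l %% m)%Z| < `|m|)%N
    by rewrite -ltz_nat !abszE ger0_norm ?modz_ge0 ?ltz_mod.
have iE : (`|(l %% m)%Z|%:Z = (l %% m)%Z)%R
    by rewrite abszE ger0_norm ?modz_ge0.
have def_x' : x = (u *~ `|(l %% m)%Z|%:Z + edge_vec e b *~ (l %/ m)%Z)%R.
  by rewrite iE def_x aE -mulrzA -mulrzDr addrC mulrC [in LHS](divz_eq l m).
apply: (NP (Ordinal lti) _ (l %/ m)%Z); last by rewrite /= -def_x'.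
move=> i /= ui; apply: (nx (i + (l %/ m)%Z)%R).
by rewrite def_x' ui mulrzDr.
Qed.

(** The tuple is made of the indices of N in the edge groups: N contains the
    subgroups generated by the multiples, and any root in N of an edge element
    is an edge element, hence a multiple of the generator of its intersection
    with N. *)
Lemma isolable_regulating : edges_isolable -> has_regulating_tuple G.
Proof.
move=> iso.
have [|[e b]|N [nN fN NP]] := @finite_index_bigI _ (edge G * bool)%type
    (fun eb N => isolates N eb.1 eb.2).
- by move=> [e b] N M isoN subMN x xP /subMN; exact: isoN.
- exact: isolable_edge_end.
pose S e : set int :=
  [set j | N (at_vertex (endpoint e false) (edge_vec e false *~ j)%R)].
have SP e b j :
    N (at_vertex (endpoint e b) (edge_vec e b *~ j)%R) <-> S e j.
  by rewrite -(conj_end_normal e b _ nN) conj_end_edge_vec.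
have sS e : zsubgroup (S e).
  split=> [|i j Si Sj]; rewrite /S /=.
    by rewrite mulr0z at_vertex0; exact: subgroup1 nN.1.
  by rewrite mulrzBr at_vertexB; exact: nN.1.2.
have /choice[k kP] e : exists k : int,
    [/\ k != 0%R, S e k & forall j, S e j -> (k %| j)%Z].
  have [k Sk k_dvd] := int_subgroup_principal (sS e); exists k; split=> //.
  have [n n0 Nn] :=
    finite_index_power (at_vertex (endpoint e false) (edge_vec e false)) fN.
  apply: contraTneq n0 => k0.
  have /k_dvd : S e n by rewrite /S /= -pmulrn at_vertexMn.
  by rewrite k0 dvd0z eqz_nat => /eqP->.
have subN v (a : vgroup v) : vgroup_multiple k a -> N (in_vertex a).
  apply: (@smallest_sub _ _ _ [set a | N (in_vertex a)]) => [|b [e c x]].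
    split=> [|x y Nx Ny]; last by rewrite /= in_vertexB; exact: nN.1.2.
    rewrite /= -(raddf0 (of_coord v)) -/(at_vertex v _) at_vertex0.
    exact: subgroup1 nN.1.
  have [n ->] := edge_genP x.
  rewrite -mulrzA /= -of_coord_edge_vec -/(at_vertex _ _); apply/SP.
  by have [_ /(zsubgroupMz n (sS e)) + _] := kP e; rewrite mulrzz mulrC.
exists k => e g /edge_generator[s [t [st ->]]] b.
have [k0 Sk k_dvd] := kP e.
have s0 : s != 0%R by apply: contra_eqN st => /eqP->; rewrite mul0r.
have gE : attach e b (edge_gen e *~ s *~ k e)%R =
    of_coord _ (edge_vec e b *~ (s * k e))%R.
  by rewrite of_coord_edge_vec mulrzA.
split.
- by apply: sub_gen_smallest; exact: (@AttachedMultiple G k).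
- rewrite gE -(raddf0 (of_coord _)) => /(can_inj (@of_coordK G _)).
  move/vec_torsionfree; rewrite mulf_neq0 // => /(_ isT)/eqP.
  by rewrite (negbTE (edge_vec_neq0 e b)).
move=> x n /subN Nx n2; rewrite gE -[x]coordK -raddfMz.
move=> /(can_inj (@of_coordK G _)) xn.
move: Nx; rewrite -[x]coordK -/(at_vertex _ _) => Nx.
have [|l xl] := NP (e, b) (coord x) _ Nx.
  exists n, (s * k e)%R; rewrite xn; split=> //.
  by apply: contraTneq n2 => ->.
have sk : (s * k e = l * n)%R.
  by apply: (vec_mulz_inj (edge_vec_neq0 e b)); rewrite /= xn xl mulrzA.
move: Nx; rewrite xl => /SP/k_dvd /dvdzP[q lq].
have sq : s = (q * n)%R by apply: (mulIf k0); rewrite sk lq mulrAC.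
have /(congr1 absz) : (n * (q * t) = 1)%R.
  by rewrite mulrA [(n * q)%R]mulrC -sq.
rewrite abszM; move: n2; case: `|n|%N => [|[|n']] // _ /eqP.
by rewrite muln_eq1.
Qed.

End Isolation.

(** * Lattices in the plane *)

Section Lattices.
Implicit Types (L : set vec) (x y : vec) (a b c : int).

Definition triangular a b c y : vec := (a * y.1, b * y.1 + c * y.2)%R.

Lemma triangularB a b c : {morph triangular a b c : x y / (x - y)%R}.
Proof. by move=> x y; rewrite /triangular; congr pair; rewrite /=; ring. Qed.

Definition triangular_map a b c : {additive vec -> vec} :=
  additive_of (@triangularB a b c).

(** Hermite normal form of a subgroup of the integer plane, completed to a
    subgroup of rank 2 by adding a direct summand, which creates no roots of
    elements of the subgroup. *)
Lemma lattice_completion L : zsubgroup L ->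
  exists a b c, [/\ a != 0%R, c != 0%R,
  forall x, L x -> exists y, x = triangular a b c y &
  forall y n, n != 0%R -> L (triangular a b c y *~ n)%R ->
    L (triangular a b c y)].
Proof.
move=> sL.
have [|c0 Lc0 c0P] := @int_subgroup_principal [set z | L (0, z)%R].
  by split=> [|x y Lx Ly]; [exact: sL.1|exact: (sL.2 _ _ Lx Ly)].
have [|a0 [b0 La0] a0P] := @int_subgroup_principal [set z | exists t, L (z, t)].
  split=> [|x y [t Lx] [t' Ly]]; first by exists 0%R; exact: sL.1.
  by exists (t - t')%R; exact: sL.2 _ _ Lx Ly.
pose c : int := if c0 == 0%R then 1%R else c0.
have c_neq0 : c != 0%R by rewrite /c; case: ifPn.
have Lc z : L (0, z)%R -> exists i, z = (c * i)%R.
  move=> /c0P/dvdzP[i ->]; rewrite /c; case: ifP => [/eqP->|_].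
    by exists 0%R; rewrite !mulr0.
  by exists i; rewrite mulrC.
have Lci i n : n != 0%R -> L (0, c * i * n)%R -> L (0, c * i)%R.
  rewrite /c; case: ifPn => [/eqP c00|_] n0; last first.
    by move=> _; have := zsubgroupMz i sL Lc0; rewrite vecMz mul0r.
  move=> /c0P; rewrite c00 dvd0z mul1r mulf_eq0 (negbTE n0) orbF => /eqP->.
  exact: sL.1.
have [a00|a0_neq0] := eqVneq a0 0%R.
  exists 1%R, 0%R, c; split=> // [[x1 x2] Lx|y n n0].
    have x10 : x1 = 0%R by apply/eqP; rewrite -dvd0z -a00; apply: a0P;
      exists x2.
    have [|i ->] := Lc x2; first by rewrite -x10.
    by exists (0, i)%R; rewrite /triangular /= x10 !mulr0 add0r.
  rewrite vecMz /triangular /= mul1r mul0r add0r => Ly.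
  have y10 : y.1 = 0%R.
    have : (a0 %| (y.1 * n)%R)%Z by apply: a0P; eexists; exact: Ly.
    by rewrite a00 dvd0z mulf_eq0 (negbTE n0) orbF => /eqP.
  by move: Ly; rewrite y10 mul0r; exact: Lci.
have Lab j : L (a0 * j, b0 * j)%R by have := zsubgroupMz j sL La0;
  rewrite vecMz.
exists a0, b0, c; split=> // [[x1 x2] Lx|[y1 y2] n n0].
  have /dvdzP[j x1j] : (a0 %| x1)%Z by apply: a0P; exists x2.
  have [|i x2i] := Lc (x2 - b0 * j)%R.
    rewrite (_ : (0, x2 - b0 * j) = (x1, x2) - (a0 * j, b0 * j))%R; last first.
      by congr pair; rewrite /= x1j; ring.
    exact: (sL.2 _ _ Lx (Lab j)).
  by exists (j, i); rewrite /triangular /= -x2i addrC subrK x1j mulrC.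
rewrite vecMz /triangular /= => Ly.
have Lcn : L (0, c * y2 * n)%R.
  rewrite (_ : (0, c * y2 * n) = (a0 * y1 * n, (b0 * y1 + c * y2) * n) -
      (a0 * (y1 * n), b0 * (y1 * n)))%R; last by congr pair; rewrite /=; ring.
  exact: (sL.2 _ _ Ly (Lab (y1 * n)%R)).
rewrite (_ : (a0 * y1, b0 * y1 + c * y2) = (a0 * y1, b0 * y1) + (0, c * y2))%R.
  exact: (zsubgroupD sL (Lab y1) (Lci _ _ n0 Lcn)).
by congr pair; rewrite /=; ring.
Qed.

End Lattices.

(** * Primitive models *)

Section Models.
Variable G : tubular_group.

(** A primitive tubular group with the graph of G, given by the unimodular
    vectors [model_vec e b] that generate the edge groups in vertex groups all
    equal to the integer plane. It is a domain of G through the maps [model_to]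
    and a target of G through the maps [model_from], which are inverse to each
    other up to the factor [model_exp]. *)
Record primitive_model := PrimitiveModel {
  model_exp : nat;
  model_to : vertex G -> {additive vec -> vec};
  model_from : vertex G -> {additive vec -> vec};
  model_index : edge G -> int;
  model_coindex : edge G -> int;
  model_vec : edge G -> bool -> vec;
  model_exp_gt1 : (1 < model_exp)%N;
  model_fromK : forall v x, model_to v (model_from v x) = (x *~ model_exp)%R;
  model_toK : forall v x, model_from v (model_to v x) = (x *~ model_exp)%R;
  model_vecU : forall e b, unimodular (model_vec e b);
  model_to_vec : forall e b,
    model_to (endpoint e b) (model_vec e b) = (edge_vec e b *~ model_index e)%R;
  model_from_vec : forall e b,
    model_from (endpoint e b) (edge_vec e b) =
      (model_vec e b *~ model_coindex e)%R
}.

Variable P : primitive_model.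

Lemma model_exp_neq0 : ((model_exp P)%:Z != 0)%R.
Proof. by rewrite eqz_nat -lt0n (ltn_trans _ (model_exp_gt1 P)). Qed.

Lemma model_to_inj v : injective (model_to P v).
Proof. by move=> x y xy; apply: (vecMzI model_exp_neq0);
  rewrite /= -(model_toK P v x) -(model_toK P v y) xy. Qed.

Lemma model_from_inj v : injective (model_from P v).
Proof. by move=> x y xy; apply: (vecMzI model_exp_neq0);
  rewrite /= -(model_fromK P v x) -(model_fromK P v y) xy. Qed.

Lemma model_index_neq0 e : model_index P e != 0%R.
Proof.
apply/eqP => k0; have /eqP := unimodular_neq0 (model_vecU P e false); apply.
by apply: (@model_to_inj (endpoint e false));
  rewrite model_to_vec k0 mulr0z raddf0.
Qed.

Lemma model_coindex_neq0 e : model_coindex P e != 0%R.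
Proof.
apply/eqP => k0; have /eqP := edge_vec_neq0 e false; apply.
by apply: (@model_from_inj (endpoint e false));
  rewrite model_from_vec k0 mulr0z raddf0.
Qed.

End Models.

(** The subgroups generated by the multiples of the edge groups, completed to
    rank 2, are the vertex groups of a primitive model. *)
Lemma regulating_model (G : tubular_group) :
  has_regulating_tuple G -> inhabited (primitive_model G).
Proof.
case=> k reg.
pose L (v : vertex G) : set vec := [set x | vgroup_multiple k (of_coord v x)].
have sL v : zsubgroup (L v).
  split=> [|x y Lx Ly]; rewrite /L /=.
    by rewrite raddf0 => S [[S0 _] _].
  by rewrite raddfB => S [sS SG]; apply: sS.2; [exact: (Lx S)|exact: (Ly S)].
have /choice[abc abcP] v : exists abc : int * int * int, let:
    (a, b, c) := abc in
    [/\ a != 0%R, c != 0%R, forall x, L v x ->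
      exists y, x = triangular a b c y &
     forall y n, n != 0%R -> L v (triangular a b c y *~ n)%R ->
       L v (triangular a b c y)].
  by have [a [b [c abcP]]] := lattice_completion (sL v); exists (a, b, c).
pose a v := (abc v).1.1; pose b v := (abc v).1.2; pose c v := (abc v).2.
have {}abcP v : [/\ a v != 0%R, c v != 0%R,
     forall x, L v x -> exists y, x = triangular (a v) (b v) (c v) y &
     forall y n, n != 0%R -> L v (triangular (a v) (b v) (c v) y *~ n)%R ->
       L v (triangular (a v) (b v) (c v) y)].
  by have := abcP v; rewrite /a /b /c; case: (abc v) => [[]].
(* A common multiple of the determinants; the factor 2 makes it a modulus of a
   nonzero ring. *)
pose n : nat := (2 * \prod_v absz (a v * c v)%R)%N.
have n1 : (1 < n)%N.
  apply: (@leq_trans (2 * 1)) => //; rewrite leq_mul //.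
  by rewrite prodn_gt0 // => v; rewrite absz_gt0 mulf_neq0 //;
    have [] := abcP v.
have /choice[q qP] v : exists q, (n%:Z = q * (a v * c v))%R.
  suff /dvdzP[q ->] : ((a v * c v)%R %| n%:Z%R)%Z by exists q.
  have dvd_n : (absz (a v * c v)%R %| n)%N.
    by rewrite /n (bigD1 v) //; apply: dvdn_mull; exact: dvdn_mulr.
  exact: dvd_n.
pose M v := triangular_map (a v) (b v) (c v).
pose f v := triangular_map (q v * c v)%R (- (q v * b v))%R (q v * a v)%R.
have fK v x : M v (f v x) = (x *~ n)%R.
  by rewrite vecMz (qP v); case: x => x1 x2; congr pair; rewrite /=; ring.
have MK v x : f v (M v x) = (x *~ n)%R.
  by rewrite vecMz (qP v); case: x => x1 x2; congr pair; rewrite /=; ring.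
have n0 : (n%:Z != 0)%R by rewrite eqz_nat -lt0n (ltn_trans _ n1).
have M_inj v : injective (M v).
  by move=> x y xy; apply: (vecMzI n0); rewrite /= -(MK v x) -(MK v y) xy.
have reg' e d : primitive_in (@vgroup_multiple _ k (endpoint e d))
    (of_coord _ (edge_vec e d *~ k e)%R).
  rewrite of_coord_edge_vec; apply: reg; apply/seteqP; split=> // x _.
  by have [j ->] := edge_genP x; exists j.
have k0 e : k e != 0%R.
  by apply/eqP => ke0; have [_ + _] := reg' e false; rewrite ke0 mulr0z raddf0.
have /choice[u uP] (ed : edge G * bool) : exists u, unimodular u /\
    M (endpoint ed.1 ed.2) u = (edge_vec ed.1 ed.2 *~ k ed.1)%R.
  case: ed => e d /=; have [La Na prim] := reg' e d.
  have [_ _ /(_ _ La)[y yE] isol] := abcP (endpoint e d).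
  have y0 : y != 0%R.
    by apply/eqP => y0; apply: Na;
      rewrite yE y0 [triangular _ _ _ _](raddf0 (M _)) raddf0.
  have [u [m [uU m0 yu]]] := exists_unimodular y0.
  have LMu : L (endpoint e d) (M (endpoint e d) u).
    refine (isol u m m0 _).
    by rewrite -[triangular _ _ _ _]/(M (endpoint e d) u) -(raddfMz (M _))
      -yu /= -yE.
  have m_small : (`|m| < 2)%N.
    rewrite ltnNge; apply/negP => m2; apply: (prim _ m LMu m2).
    by rewrite -raddfMz -(raddfMz (M _)) -yu yE.
  exists y; split=> //; have [w wu] := uU.
  have mm : (m * m = 1)%R by move: m0 m_small; case: m {yu} => [[|[|m]]|[|m]].
  exists (w *~ m)%R; rewrite yu !vecMz /=.
  transitivity ((w.1 * u.1 + w.2 * u.2) * (m * m))%R; first by ring.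
  by rewrite wu mm.
have uU e d : unimodular (u (e, d)) by have [] := uP (e, d).
have Mu e d : M (endpoint e d) (u (e, d)) = (edge_vec e d *~ k e)%R
    by have [] := uP (e, d).
have fu e d : f (endpoint e d) (edge_vec e d) = (u (e, d) *~ (n %/ k e)%Z)%R.
  have [|i [-> ->]] :=
      @unimodular_div (u (e, d)) (f (endpoint e d) (edge_vec e d)) (k e) n%:Z%R
      (uU e d) (k0 e).
    by rewrite -raddfMz -Mu MK.
  by rewrite mulzK.
by constructor; exact: (@PrimitiveModel G n M f k (fun e => (n %/ k e)%Z)
  (fun e d => u (e, d)) n1 fK MK uU Mu fu).
Qed.

(** * Primitive domains and targets *)

Lemma intmulB (A : zmodType) (a : A) : {morph intmul a : m n / (m - n)%R}.
Proof. by move=> m n; rewrite mulrzBr. Qed.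

Definition multiples (A : zmodType) (a : A) : {additive int -> A} :=
  additive_of (@intmulB A a).

Definition additive_comp (A B C : zmodType) (f : {additive B -> C}) (g :
    {additive A -> B}) :
  {additive A -> C} := [the {additive A -> C} of f \o g].

Section ModelGroup.
Variables (G : tubular_group) (P : primitive_model G).

Definition model_graph : graph_of_groups :=
  @GraphOfGroups (vertex G) (edge G) (@endpoint G) (fun=> vec) (fun=> int)
    (fun e b => multiples (model_vec P e b)).

Lemma model_graph_tubular : tubular model_graph.
Proof.
have [conn _ _ _] := splittingP G; split=> //.
- by move=> v; exists (idfun : {additive vec -> vec}); exists id.
- by move=> e; exists (idfun : {additive int -> int}); exists id.
- by move=> e b; exact/vec_mulz_inj/unimodular_neq0/model_vecU.
Qed.

Definition model_group : tubular_group :=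
  @TubularGroup model_graph model_graph_tubular (tree G) (treeP G).

Lemma model_group_primitive : primitive model_group.
Proof. by move=> e b; exact/maximal_cyclic_unimodular/model_vecU. Qed.

Lemma model_domain : has_primitive_domain G.
Proof.
exists model_group; last exact: model_group_primitive.
have [|||F [Fv Fe]] := @pi1_lift model_group (pi1 G)
    (fun v (x : vec) => @at_vertex G v (model_to P v x)) (@stable_letter G).
- by move=> v x y; rewrite -at_vertexD -raddfD.
- move=> e n; rewrite /= !raddfMz !model_to_vec -!mulrzA.
  exact: (esym (@at_dart_rel G (e, true) (model_index P e * n)%R)).
- by move=> e; exact: (@stable_letter_tree G e).
constructor; unshelve refine (@RigidMorphism model_group G F id id (fun=> false)
    (fun v => additive_comp (@of_coord G v) (model_to P v)) (fun e =>
      multiples (@edge_gen G e *~ model_index P e)%R)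
    _ _ _ _ _ _ _ _ _).
- by exists id.
- by exists id.
- by move=> e b; rewrite addbF.
- by move=> v x y /(can_inj (@of_coordK G _))/model_to_inj.
- move=> e m n; rewrite /= -!mulrzA => /edge_gen_inj.
  by apply: mulfI; exact: model_index_neq0.
- move=> e b n;
    rewrite addbF /= -mulrzA -of_coord_edge_vec mulrzA -model_to_vec -raddfMz.
  by [].
- by [].
- by move=> v a; rewrite Fv.
- by move=> e; rewrite Fe.
Qed.

Lemma model_target : has_primitive_target G.
Proof.
exists model_group; last exact: model_group_primitive.
have [|||F [Fv Fe]] := @pi1_lift G (pi1 model_group)
    (fun v (a : vgroup v) =>
      @in_vertex model_group v (model_from P v (coord a)))
    (@stable_letter model_group).
- by move=> v x y; rewrite coordD raddfD (@in_vertexD model_group).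
- move=> e z; have [n ->] := edge_genP z.
  rewrite -!of_coord_edge_vec !of_coordK !raddfMz !model_from_vec -!mulrzA.
  exact: (@stable_letter_rel model_group e (model_coindex P e * n)%R).
- by move=> e; exact: (@stable_letter_tree model_group e).
have exc (e : edge G) (z : egroup e) := edge_genP z.
pose ec e (z : egroup e) : int := (model_coindex P e * sval (cid (exc e z)))%R.
have ecE e n : ec e (edge_gen e *~ n)%R = (model_coindex P e * n)%R.
  congr (_ * _)%R; apply: (@edge_gen_inj G e); symmetry.
  exact: (svalP (cid (exc e (edge_gen e *~ n)%R))).
have ecB e : {morph ec e : x y / (x - y)%R}.
  move=> x y; have [m ->] := edge_genP x; have [n ->] := edge_genP y.
  by rewrite -mulrzBr !ecE mulrBr.
constructor; unshelve refine (@RigidMorphism G model_group F id id (fun=> false)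
    (fun v => additive_comp (model_from P v) (@coord_additive G v))
    (fun e => additive_of (@ecB e)) _ _ _ _ _ _ _ _ _).
- by exists id.
- by exists id.
- by move=> e b; rewrite addbF.
- by move=> v x y /model_from_inj/(can_inj (@coordK G _)).
- move=> e x y; have [m ->] := edge_genP x; have [n ->] := edge_genP y.
  by rewrite /= !ecE => /(mulfI (model_coindex_neq0 P e)) ->.
- move=> e b z; have [n ->] := edge_genP z; rewrite addbF /= ecE.
  by rewrite -of_coord_edge_vec of_coordK raddfMz model_from_vec -mulrzA.
- by [].
- by move=> v a; rewrite Fv.
- by move=> e; rewrite Fe.
Qed.

End ModelGroup.

(** A root of the generator would span a larger cyclic subgroup. *)
Lemma primitive_attach_gen (D : tubular_group) (e : edge D) b (x :
    egroup e) (y : vgroup (endpoint e b)) n :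
    primitive D -> (forall z : egroup e, exists k, z = (x *~ k)%R) ->
  attach e b x = (y *~ n)%R -> `|n| = 1%N.
Proof.
move=> primD genx xy; have [_ maxC] := primD e b.
have sub : range (attach e b) `<=` cyclic_subgroup y.
  move=> _ [z _ <-]; have [k ->] := genx z.
  by exists (n * k)%R; rewrite ?raddfMz /= ?xy ?mulrzA.
have [z _ zy] : range (attach e b) y.
  by rewrite (maxC y sub); exists 1%R; rewrite ?mulr1z.
have [k zx] := genx z; have [_ _ _ inj] := splittingP D.
have xkn : x = (x *~ (k * n))%R.
  by apply: (inj e b); rewrite xy -zy -raddfMz zx -mulrzA.
have [s xs] := edge_genP x; have [t] := genx (edge_gen e).
rewrite xs -mulrzA -{1}[edge_gen e]mulr1z => /edge_gen_inj st.
move: xkn; rewrite xs -mulrzA => /edge_gen_inj skn.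
have : (n * (k * (s * t)) = 1)%R.
  by rewrite [RHS]st [in RHS]skn; ring.
by move/(congr1 absz); rewrite abszM => /eqP; rewrite muln_eq1 => /andP[/eqP].
Qed.

Lemma Tagged_vgroup_inj (D : graph_of_groups) (v : vertex D) (a b : vgroup v) :
  Tagged vgroup a = Tagged vgroup b -> a = b.
Proof. by move/eqP; rewrite eq_Tagged => /eqP. Qed.

Lemma vgroup_torsionfree (G : tubular_group) (v : vertex G) (n : int) :
  n != 0%R -> injective (fun a : vgroup v => (a *~ n)%R).
Proof.
move=> n0 a b; rewrite -[a]coordK -[b]coordK -!raddfMz.
by move=> /(can_inj (@of_coordK G v))/(vecMzI n0) ->.
Qed.

(** The index of the edge group of a primitive domain, in the edge group of G,
    regulates: the vertex groups of the domain contain the subgroups generated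
    by the multiples, and primitivity passes to subgroups. *)
Lemma domain_regulating G : has_primitive_domain G -> has_regulating_tuple G.
Proof.
case=> G' [f] prim.
have [ri riK Kri] := rm_edge_bij f.
have /choice[k' k'P] (e : edge G') :
    exists k, rm_egroup f e (edge_gen e) = (edge_gen (rm_edge f e) *~ k)%R.
  exact: edge_genP.
pose k e := k' (ri e).
have kE e : k (rm_edge f e) = k' e by rewrite /k riK.
have gen_image e s : (edge_gen (rm_edge f e) *~ s *~ k (rm_edge f e))%R =
    rm_egroup f e (edge_gen e *~ s)%R.
  by rewrite raddfMz /= k'P kE -!mulrzA mulrC.
have attached_image v (a : vgroup v) : attached_multiple k a ->
    forall v', v = rm_vertex f v' ->
    exists y, Tagged vgroup a = Tagged vgroup (rm_vgroup f v' y).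
  case=> e b x v'; rewrite -(Kri e) in x *; move: (ri e) x => {}e x.
  rewrite -[b](addbK (rm_flip f e)); move: (b (+) _) => {}b eq_v.
  have <- : endpoint e b = v'.
    by apply: (bij_inj (rm_vertex_bij f)); rewrite -rm_endpoint.
  have [j ->] := edge_genP x; exists (attach e b (edge_gen e *~ j)%R).
  by rewrite gen_image rm_attach.
have image v' (a : vgroup (rm_vertex f v')) : vgroup_multiple k a ->
    exists y, a = rm_vgroup f v' y.
  apply: (@smallest_sub _ _ _ [set a | exists y, a = rm_vgroup f v' y]) =>
    [|{}a ma].
    split=> [|_ _ [x ->] [y ->]]; first by exists 0%R; rewrite raddf0.
    by exists (x - y)%R; rewrite raddfB.
  by have [y /Tagged_vgroup_inj] := attached_image _ a ma v' erefl; exists y.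
exists k => e; rewrite -(Kri e);
  move: (ri e) => {}e g /edge_generator[s [t [st ->]]] b.
rewrite -[b](addbK (rm_flip f e)); move: (b (+) _) => {}b.
set a := attach _ _ _.
have ma : vgroup_multiple k a.
  by apply: sub_gen_smallest; exact: (@AttachedMultiple G k).
have := rm_attach f b (edge_gen e *~ s)%R; rewrite -gen_image -/a.
move: (endpoint _ _) a ma => v a ma aE.
pose Q (u : {v : vertex G & vgroup v}) :=
  vgroup_multiple k (tagged u) ->
    primitive_in (@vgroup_multiple G k (tag u)) (tagged u).
suff : Q (Tagged vgroup a) by apply.
rewrite aE /Q /= => ma'; split=> //.
  rewrite -(raddf0 (rm_vgroup f _)) => /rm_vgroup_inj.
  have [_ _ _ inj] := splittingP G'; rewrite -(raddf0 (attach e b)) => /inj.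
  exact: edge_gen_unit_neq0 st.
move=> y0 n /image[y ->] n2; rewrite -raddfMz => /rm_vgroup_inj.
move/(primitive_attach_gen prim (edge_gen_unit st)) => n1.
by rewrite n1 in n2.
Qed.

(** Divide a common multiple of the indices of the edge groups in those of a
    primitive target by each of them. *)
Lemma target_regulating G : has_primitive_target G -> has_regulating_tuple G.
Proof.
case=> G' [f] prim.
have /choice[d dP] (e : edge G) :
    exists d, rm_egroup f e (edge_gen e) = (edge_gen (rm_edge f e) *~ d)%R.
  exact: edge_genP.
have d0 e : d e != 0%R.
  apply/eqP => de0; have := @edge_gen_unit_neq0 G e 1 1 erefl; apply.
  by apply: (@rm_egroup_inj _ _ f e); rewrite mulr1z dP de0 mulr0z raddf0.
pose N := (\prod_e d e)%R; pose k e := (\prod_(e' | e' != e) d e')%R.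
have N0 : N != 0%R by apply/prodf_neq0.
have dk e : (d e * k e = N)%R by rewrite /N (bigD1 e).
have gen_image e s : rm_egroup f e (edge_gen e *~ s *~ k e)%R =
    (edge_gen (rm_edge f e) *~ s *~ N)%R.
  by rewrite !raddfMz /= dP -!mulrzA -(dk e); congr (_ *~ _)%R; ring.
have attach_image (e : edge G) b s :
    Tagged vgroup (rm_vgroup f _ (attach e b (edge_gen e *~ s *~ k e)%R)) =
    Tagged vgroup (attach (rm_edge f e) (b (+) rm_flip f e)
                     (edge_gen (rm_edge f e) *~ s)%R *~ N)%R.
  by rewrite -rm_attach gen_image raddfMz.
pose R n (u : {v : vertex G' & vgroup v}) := exists y, tagged u = (y *~ n)%R.
have image v (a : vgroup v) : vgroup_multiple k a ->
    exists y, rm_vgroup f v a = (y *~ N)%R.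
  apply: (@smallest_sub _ _ _ [set a | exists y, rm_vgroup f v a = (y *~ N)%R])
    => [|{}a].
    split=> [|x x' [y xy] [y' xy']]; first by exists 0%R; rewrite raddf0 mul0rz.
    by exists (y - y')%R; rewrite raddfB /= xy xy' mulrzBl.
  case=> e b x; have [j ->] := edge_genP x.
  suff : R N (Tagged vgroup
      (rm_vgroup f _ (attach e b (edge_gen e *~ j *~ k e)%R))) by [].
  by rewrite attach_image; eexists.
exists k => e g /edge_generator[s [t [st ->]]] b.
have [_ _ _ inj] := splittingP G; split.
- by apply: sub_gen_smallest; exact: (@AttachedMultiple G k).
- rewrite -(raddf0 (attach e b)) => /inj eg0;
    apply: (@edge_gen_unit_neq0 G' (rm_edge f e) _ _ st).
  have := gen_image e s; rewrite eg0 raddf0 => /esym.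
  rewrite -mulrzA -[X in X = _ ->
    _]/(edge_gen _ *~ _)%R -(mulr0z (edge_gen (rm_edge f e))).
  move=> /edge_gen_inj/eqP; rewrite mulf_eq0 (negbTE N0) orbF => /eqP ->.
  by rewrite mulr0z.
move=> y0 n /image[y y0y] n2 root.
have : R (n * N)%R
    (Tagged vgroup (rm_vgroup f _ (attach e b (edge_gen e *~ s *~ k e)%R))).
  by exists y; rewrite /= root raddfMz /= y0y -!mulrzA mulrC.
rewrite attach_image => -[z /=]; rewrite mulrzA => /(vgroup_torsionfree N0).
by move/(primitive_attach_gen prim (edge_gen_unit st)) => n1; rewrite n1 in n2.
Qed.

(** * Finite quotients from a primitive model *)

Lemma kernel_finite_index (K : groupType) (T : finType) (F :
    {multiplicative K -> permutation T}) :
  normal_subgroup [set g | F g = 1] /\ finite_index [set g | F g = 1].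
Proof.
have nF : normal_subgroup [set g | F g = 1].
  split; first split=> [|x y Fx Fy]; rewrite /= ?mult1 //.
    by rewrite gmulfM multV Fx Fy invg1 mulg1.
  by move=> g x /= Fx; rewrite !gmulfM multV Fx mulg1 mulgV.
split=> //; apply: (@code_finite_index _ _ _ (fun g => [ffun s => F g s]));
  first by case: nF.
move=> x y; rewrite /= gmulfM multV; split=> [/ffunP xy|xy].
  have -> : F x = F y.
    by apply: eq_permutation => s; have := xy s; rewrite !ffunE.
  by rewrite mulVg.
by apply/ffunP => s; rewrite !ffunE -(mulg1_eq xy) invgK.
Qed.

Section Reduction.
Variables (G : tubular_group) (P : primitive_model G) (n : nat).
Hypothesis n1 : (1 < n)%N.

Definition reduction (v : vertex G) : {additive vec -> ('Z_n * 'Z_n)%type} :=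
  additive_comp (vec_cast_additive 'Z_n) (model_from P v).

Lemma reduction_eq0 v x : reduction v x = 0%R <->
    exists y, model_from P v x = (y *~ n)%R.
Proof. exact: vec_cast_eq0. Qed.

Definition reduction_representation :=
  @affine_representation G 'Z_n reduction (fun e => (model_coindex P e)%:~R%R)
    (fun e b => vec_cast 'Z_n (model_vec P e b))
    (fun e b => @vec_cast_unimodular 'Z_n _ (model_vecU P e b))
    (fun e b => etrans (congr1 (vec_cast 'Z_n) (model_from_vec P e b))
                       (vec_cast_scale 'Z_n _ _)).

End Reduction.

Section Residual.
Variables (G : tubular_group) (P : primitive_model G).

Lemma syllable_separated (x : vec) (d : dart G) :
    (forall k, x <> (edge_vec d.1 (~~ d.2) *~ k)%R) ->
  exists2 n1, (0 < n1)%N & forall n k y, n1 %| n ->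
    (model_from P (dart_from d) x <>
     model_vec P d.1 (~~ d.2) *~ (model_coindex P d.1 * k) + y *~ n)%R.
Proof.
move=> nx; apply: line_separated;
  [exact: model_vecU|exact: model_coindex_neq0|].
move=> k; rewrite mulrzA -model_from_vec -raddfMz => /model_from_inj.
exact: nx.
Qed.

(** Modulo a suitable integer, the syllables of a reduced path stay out of the
    edge groups: a primitive line remains distinct from everything that is not
    on it. The path representation over the integers modulo that integer is
    then a finite quotient that sees the reduced path. *)
Lemma model_quotient (v : vertex G) (C : set vec) g :
    (forall c, ~ C c -> exists2 n1, (0 < n1)%N & forall n x y, n1 %| n -> C x ->
       model_from P v c <> (model_from P v x + y *~ n)%R) ->
    (forall x, C x -> g <> at_vertex v x) ->
  exists N, [/\ normal_subgroup N, finite_index N &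
    forall x, C x -> ~ N ((at_vertex v x)^-1 * g)].
Proof.
move=> sepC gC; have [p [c [walk_p red_p def_g]]] := exists_reduced_expr v v g.
have /choice[q qP] (xd : vec * dart G) : exists n1, (0 < n1)%N /\
    ((forall k, xd.1 <> (edge_vec xd.2.1 (~~ xd.2.2) *~ k)%R) ->
     forall n k y, n1 %| n -> (model_from P (dart_from xd.2) xd.1 <>
       model_vec P xd.2.1 (~~ xd.2.2) *~ (model_coindex P xd.2.1 * k) + y
         *~ n)%R).
  case: xd => x d /=.
  have [nx|nnx] := pselect (forall k, x <> (edge_vec d.1 (~~ d.2) *~ k)%R).
    by have [n1 n1_gt0 n1P] := syllable_separated nx; exists n1.
  by exists 1%N.
have [r r_gt0 rP] :
    exists2 r, (0 < r)%N & (~ C c -> forall n x y, r %| n -> C x ->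
       model_from P v c <> (model_from P v x + y *~ n)%R).
  have [Cc|/sepC[r r0 rP]] := pselect (C c); first by exists 1%N.
  by exists r.
(* The factor 2 makes it a modulus of a nonzero ring. *)
pose n := (2 * (r * \prod_(xd <- p) q xd))%N.
have n1 : (1 < n)%N.
  apply: (@leq_trans (2 * 1)) => //;
    rewrite leq_mul // muln_gt0 r_gt0 prodn_gt0 //.
  by move=> xd; have [] := qP xd.
have r_dvd : r %| n by rewrite /n mulnCA dvdn_mulr.
have q_dvd xd : xd \in p -> q xd %| n.
  by move=> xd_p; rewrite /n mulnA dvdn_mull // (big_rem xd) // dvdn_mulr.
have red_p' : reduced_path (fun e b => vscale (model_coindex P e)%:~R%R
    (vec_cast 'Z_n (model_vec P e b))) (path_image (reduction P n) p).
  apply: path_image_reduced red_p => x d xd_p [k].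
  rewrite -vec_cast_scale -(raddfMz (vec_cast_additive 'Z_n)) => /eqP.
  rewrite -subr_eq0 -(raddfB (vec_cast_additive 'Z_n)) =>
    /eqP /(vec_cast_eq0 _ n1)[y xy].
  apply: contrapT => /forallNP nx; have [_ /(_ nx)] := qP (x, d).
  move/(_ n k y (q_dvd _ xd_p)); apply; rewrite /= mulrzA.
  by move/eqP: xy; rewrite subr_eq addrC => /eqP.
have [F [h [h0 Fv [z Fz]]]] :=
    @reduction_representation G P n v p c walk_p red_p'.
have [nF fF] := kernel_finite_index F.
exists [set g | F g = 1]; split=> // x Cx.
rewrite /= gmulfM multV => /mulg1_eq; rewrite invgK => Fxg.
have Fw w : F (at_vertex v w) = translation _ (reduction P n v w).
  by rewrite Fv h0 invg1 mulg1 mul1g.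
case: p @n walk_p red_p def_g r_dvd q_dvd n1 red_p' F h h0 Fv z Fz nF fF Fxg Fw
    => [|xd p] n walk_p red_p def_g r_dvd q_dvd n1 red_p' F h h0 Fv z Fz nF
      fF Fxg Fw.
  have def_c : g = at_vertex v c by rewrite def_g /path_val big_nil mul1g.
  have nCc : ~ C c by move=> /gC.
  move: Fxg; rewrite def_c !Fw =>
    /(congr1 (fun s : permutation _ => (s (0%R, ord0)).1)) /=.
  rewrite !add0r => /eqP;
    rewrite eq_sym -subr_eq0 -(raddfB (reduction P n v)) => /eqP.
  move=> /(reduction_eq0 P n1 v _)[y]; rewrite raddfB => /eqP;
    rewrite subr_eq addrC => /eqP.
  exact: rP.
by move: Fz; rewrite -def_g -Fxg Fw => /(congr1 (fun s => val s.2)).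
Qed.

Lemma model_residually_finite : residually_finite (pi1 G).
Proof.
move=> g g1; have [[[v _] _] _ _ _] := splittingP G.
have [c c0|x ->|N [nN fN NP]] := @model_quotient v [set 0%R] g.
- case def_c: (model_from P v c) => [a b].
  (* Larger than both coordinates, so that a multiple of it divides them only if
     they vanish. *)
  exists (`|a| + `|b|).+1 => // n x [y1 y2] /dvdn_leq le_n ->.
  rewrite raddf0 add0r vecMz => -[aE bE]; apply: c0 => /=.
  apply: (@model_from_inj _ P v); rewrite raddf0 def_c aE bE.
  have [n0|n_gt0] := posnP n; first by rewrite n0 !mulr0.
  have {}le_n := le_n n_gt0.
  have zero y : (`|(y * n%:Z)%R| < n)%N -> (y * n%:Z = 0)%R.
    by rewrite abszM absz_nat; case: y => -[|k] //=; nia.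
  have y1n : (y1 * n%:Z = 0)%R.
    by apply: zero; rewrite -aE; apply: leq_trans le_n; rewrite ltnS leq_addr.
  have y2n : (y2 * n%:Z = 0)%R.
    by apply: zero; rewrite -bE; apply: leq_trans le_n; rewrite ltnS leq_addl.
  by rewrite y1n y2n.
- by rewrite at_vertex0.
by exists N; split=> // Ng; apply: (NP 0%R) => //;
  rewrite at_vertex0 invg1 mul1g.
Qed.

Lemma model_separable : separable_edge_groups G.
Proof.
move=> e; exists [set K | finite_index K /\ edge_subgroup e `<=` K]; split;
  first by move=> K [].
apply/seteqP; split=> g; first by move=> eg K [_]; apply.
move=> gK; apply: contrapT => ng; pose v := endpoint e false.
pose C : set vec := [set (edge_vec e false *~ k)%R | k in [set: int]].
have [c nc|x [k _ <-] gE|N [nN fN NP]] := @model_quotient v C g.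
- have [k ck|n1 n1_gt0 n1P] := @syllable_separated c (e, true).
    by apply: nc; exists k.
  exists n1 => // n _ y dvd_n [k _ <-].
  by rewrite raddfMz model_from_vec -mulrzA; exact: (n1P n k y dvd_n).
- by apply: ng; apply/edge_subgroupP; exists k.
pose K : set (pi1 G) := [set y | exists2 x, C x & N ((at_vertex v x)^-1 * y)].
have CB x y : C x -> C y -> C (x - y)%R.
  by move=> [k _ <-] [l _ <-]; exists (k - l)%R => //; rewrite mulrzBr.
have sK : subgroup K.
  split; first by exists 0%R;
    [exists 0%R|rewrite at_vertex0 mulg1 invg1; exact: subgroup1 nN.1].
  move=> a b [x Cx Na] [y Cy Nb]; exists (x - y)%R; first exact: CB.
  have -> : (at_vertex v (x - y)%R)^-1 * (a * b^-1) = at_vertex v y *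
      ((at_vertex v x)^-1 * a * ((at_vertex v y)^-1 * b)^-1)
        * (at_vertex v y)^-1.
    by rewrite at_vertexB !invgM !invgK !mulgA mulgK.
  by apply: nN.2; exact: nN.1.2.
have subNK : N `<=` K.
  move=> a Na; exists 0%R; first by exists 0%R.
  by rewrite at_vertex0 invg1 mul1g.
have [|x Cx] := gK K; last exact: NP.
split; first exact: finite_index_sup subNK.
move=> a /edge_subgroupP[k ->]; exists (edge_vec e false *~ k)%R;
  first by exists k.
by rewrite mulVg; exact: subgroup1 nN.1.
Qed.

End Residual.

(** * The action on the Bass-Serre tree *)

Section Cosets.
Variable K : groupType.
Implicit Types (B : set K) (x y : K).

Lemma ltranslateM x y B : ltranslate (x * y) B = ltranslate x (ltranslate y B).
Proof.
apply/seteqP; split=> _ [z Bz <-]; first by exists (y * z);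
  [exists z|rewrite mulgA].
by case: Bz => w Bw <-; exists w; rewrite ?mulgA.
Qed.

Lemma ltranslate1 B : ltranslate 1 B = B.
Proof.
apply/seteqP; split=> [_ [z Bz <-]|z Bz]; first by rewrite mul1g.
by exists z; rewrite ?mul1g.
Qed.

Lemma ltranslate_eq B x y : subgroup B ->
  ltranslate x B = ltranslate y B <-> exists2 b, B b & x = y * b.
Proof.
move=> sB; rewrite eq_ltranslate //; split=> [Bxy|[b Bb ->]]; last first.
  by rewrite invgM mulgVK; exact: subgroupV.
exists (y^-1 * x); last by rewrite mulVKg.
by rewrite -[_ * x]invgK invgM invgK; exact: subgroupV.
Qed.

End Cosets.

Section BassSerreAction.
Variable G : tubular_group.
Implicit Types (g h : pi1 G) (e : edge G) (v : vertex G).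

Lemma bs_actM I g h (p : I * set (pi1 G)) :
  bs_act (g * h) p = bs_act g (bs_act h p).
Proof. by rewrite /bs_act /= ltranslateM. Qed.

Lemma bs_act_coset I g x (i : I) (B : set (pi1 G)) :
  bs_act g (i, ltranslate x B) = (i, ltranslate (g * x) B).
Proof. by rewrite /bs_act /= ltranslateM. Qed.

Lemma bs_act1 I (p : I * set (pi1 G)) : bs_act 1 p = p.
Proof. by case: p => i B; rewrite /bs_act ltranslate1. Qed.

Lemma bs_actK I g (p : I * set (pi1 G)) : bs_act g^-1 (bs_act g p) = p.
Proof. by rewrite -bs_actM mulVg bs_act1. Qed.

Lemma vertex_subgroup_subgroup v : subgroup (vertex_subgroup v).
Proof.
split; first by apply/vertex_subgroupP; exists 0%R; rewrite at_vertex0.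
move=> _ _ /vertex_subgroupP[x ->] /vertex_subgroupP[y ->].
by apply/vertex_subgroupP; exists (x - y)%R; rewrite at_vertexB.
Qed.

Lemma edge_subgroup_subgroup e : subgroup (edge_subgroup e).
Proof.
split; first by apply/edge_subgroupP; exists 0%R; rewrite mulr0z at_vertex0.
move=> _ _ /edge_subgroupP[k ->] /edge_subgroupP[l ->].
by apply/edge_subgroupP; exists (k - l)%R; rewrite mulrzBr at_vertexB.
Qed.

Lemma bs_endpoint_coset e b x :
  bs_endpoint (e, ltranslate x (edge_subgroup e)) b =
  (endpoint e b, ltranslate (x * edge_end e b)
    (vertex_subgroup (endpoint e b))).
Proof.
rewrite /bs_endpoint /=; congr pair; apply/seteqP; split=> z.
  case=> w + [a va <-] => wP.
  have {wP} [k ->] : exists k, w = x * edge_end e b *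
      at_vertex (endpoint e b) (edge_vec e b *~ k)%R.
    have edgeE k : at_vertex (endpoint e false) (edge_vec e false *~ k)%R
        * edge_end e b =
        edge_end e b * at_vertex (endpoint e b) (edge_vec e b *~ k)%R.
      by rewrite -(conj_end_edge_vec e b) /conj_end mulgVK.
    case: b wP edgeE {va} => /=.
      move=> [_ [_ /edge_subgroupP[k ->] <-] <-] edgeE; exists k.
      by rewrite -!mulgA edgeE.
    by move=> [_ /edge_subgroupP[k ->] <-] _; exists k; rewrite mulg1.
  exists (at_vertex (endpoint e b) (edge_vec e b *~ k)%R * a);
    last by rewrite !mulgA.
  apply: subgroupM va; first exact: vertex_subgroup_subgroup.
  by apply/vertex_subgroupP; eexists.
case=> a va <-; exists (x * edge_end e b); last by exists a.
have x_edge : ltranslate x (edge_subgroup e) x.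
  by exists 1; rewrite ?mulg1 //; exact: (edge_subgroup_subgroup e).1.
by case: b {va} => /=; [exists x|rewrite mulg1].
Qed.

Lemma bs_endpoint_act e b x g :
  bs_endpoint (bs_act g (e, ltranslate x (edge_subgroup e))) b =
  bs_act g (bs_endpoint (e, ltranslate x (edge_subgroup e)) b).
Proof.
by rewrite bs_act_coset !bs_endpoint_coset bs_act_coset mulgA.
Qed.

End BassSerreAction.

(** In the plane, a nonzero cyclic subgroup lies in one spanned by a
    unimodular vector, which is closed under roots. *)
Lemma maximal_cyclic_isolated (D : graph_of_groups) (v : vertex D) (C :
    set (vgroup v)) y m :
  tubular D -> maximal_cyclic C -> m != 0%R -> C (y *~ m)%R -> C y.
Proof.
move=> [_ /(_ v)[f [f' f'K fK']] _ _] [[q Cq] maxC] m0.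
have f_inj : injective f := can_inj f'K.
have [q0|q0] := eqVneq (f' q) 0%R.
  rewrite Cq => -[k _]; rewrite -[q]fK' q0 raddf0 mul0rz -[y]fK' -raddfMz.
  rewrite -{1}(raddf0 f) => /f_inj/esym/vec_torsionfree/(_ m0) ->.
  by exists 0%R; rewrite // mulr0z raddf0.
have [u [c [uU c0 qE]]] := exists_unimodular q0.
rewrite (maxC (f u)).
  move=> [k _]; rewrite -[y]fK' -!raddfMz => /f_inj/esym uk.
  by have [i [-> _]] := unimodular_div uU m0 uk; exists i; rewrite // raddfMz.
rewrite Cq => _ [k _ <-]; exists (c * k)%R => //.
by rewrite -[q]fK' qE (raddfMz f) mulrzA.
Qed.

Lemma morphism_mulz (A A' : zmodType) (K : groupType) (f : A -> K) (f' : A' ->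
    K) x y n :
    {morph f : a b / (a + b)%R >-> a * b} ->
      {morph f' : a b / (a + b)%R >-> a * b} ->
  f x = f' y -> f (x *~ n)%R = f' (y *~ n)%R.
Proof.
move=> fD f'D fxy.
have f0 : f 0%R = 1 by apply: (mulgI (f 0%R)); rewrite -fD addr0 mulg1.
have f'0 : f' 0%R = 1 by apply: (mulgI (f' 0%R)); rewrite -f'D addr0 mulg1.
have fn k : f (x *+ k)%R = f' (y *+ k)%R.
  by elim: k => [|k IH]; rewrite ?mulr0n ?f0 ?f'0 // !mulrS fD f'D fxy IH.
case: n => k; first exact: fn.
rewrite NegzE !mulrNz -!pmulrn; apply: (mulgI (f (x *+ k.+1)%R)).
by rewrite -fD addrN f0 fn -f'D addrN.
Qed.

Section VirtuallyPrimitive.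
Variable G : tubular_group.

(** Primitivity of the splitting induced on H says that if an element of H
    fixes a vertex of the Bass-Serre tree and a nonzero power of it fixes an
    adjacent edge, then it fixes the edge. This is inherited by the normal core
    of H. *)
Lemma virtually_primitive_isolable : virtually_primitive G -> edges_isolable G.
Proof.
case=> H [fH [D [[S] tubD primD]]] e b a na [j [k0 [j0 aj]]].
have [sH _] := fH; have [N [nN fN subNH]] := exists_normal_core fH.
exists N; split=> // k; set x := (a + _)%R => Nx.
have xj : (x *~ j = edge_vec e b *~ (k0 + k * j))%R.
  by rewrite /x mulrzDl aj mulrzDr mulrzA.
pose y := conj_end e b (at_vertex (endpoint e b) x).
suff : edge_subgroup e y.
  move/conj_end_edge => [i xi]; apply: (na (i - k)%R).
  by rewrite mulrzBr -xi /x addrK.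
have Hy : H y by apply/subNH/(conj_end_normal e b _ nN).
have [|eps [[h Hh p0E] _]] := is_eorbit S (p := (e, edge_subgroup e)).
  by exists 1; rewrite ltranslate1.
have edge_coset g : edge_subgroup e (h * g * h^-1) <->
    bs_act g (is_erep S eps) = is_erep S eps.
  have -> : is_erep S eps = bs_act h^-1 (e, edge_subgroup e)
      by rewrite p0E bs_actK.
  rewrite -bs_actM; split=> [eg|].
    rewrite /bs_act /=; congr pair;
      apply/(ltranslate_eq _ _ (edge_subgroup_subgroup e)).
    by exists (h * g * h^-1) => //; rewrite -mulgA mulKg.
  case=> /(ltranslate_eq _ _ (edge_subgroup_subgroup e))[b' eb' ghE].
  by rewrite -mulgA ghE mulVKg.
pose c := is_conj S eps b; pose w := endpoint eps b.
have Hc : H c by exact: is_conjP.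
pose q z := c * (h^-1 * conj_end e b (at_vertex (endpoint e b) z) * h) * c^-1.
have qD : {morph q : z z' / (z + z')%R >-> z * z'}.
  by move=> z z'; rewrite /q at_vertexD conj_endM !mulgA !mulgVK mulgK mulgVK.
have Hq : H (q x).
  apply: sH.2 => //; apply: subgroupM => //; apply: subgroupM => //.
  by apply: subgroupM => //; exact: subgroupV.
have [Y _ qY] : range (@is_vgroup _ _ _ S w) (q x).
  rewrite is_vgroup_range; split=> //.
  rewrite -(is_conj_endpoint S eps b) -/c /q -bs_actM mulgVK [LHS]bs_actM;
    congr (bs_act _ _).
  have -> : is_erep S eps = bs_act h^-1 (e, ltranslate 1 (edge_subgroup e)).
    by rewrite ltranslate1 p0E bs_actK.
  rewrite bs_endpoint_act bs_endpoint_coset mul1g -bs_actM mulgK bs_actM;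
    congr (bs_act _ _).
  rewrite /bs_act /=; congr pair; rewrite -ltranslateM.
  apply/(ltranslate_eq _ _ (vertex_subgroup_subgroup _)).
  exists (at_vertex (endpoint e b) x); first by apply/vertex_subgroupP;
    exists x.
  by rewrite /conj_end mulgVK.
have qj : is_vgroup S (Y *~ j)%R = q (x *~ j)%R.
  exact: (morphism_mulz j (@is_vgroupD _ _ _ S w) qD qY).
have [z _ qz] : range (@is_egroup _ _ _ S eps) (h^-1 *
    conj_end e b (at_vertex (endpoint e b) (x *~ j)%R) * h).
  rewrite is_egroup_range; split.
    have : bs_stabilizer H (is_vrep S w) (is_vgroup S (Y *~ j)%R).
      by rewrite -is_vgroup_range; exists (Y *~ j)%R.
    case=> + _; rewrite qj /q => Hqj.
    have := subgroupM sH (subgroupV sH Hc) (subgroupM sH Hqj Hc).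
    by rewrite -!mulgA mulVg mulg1 mulKg !mulgA.
  apply/edge_coset; rewrite !mulgA mulgK mulgV mul1g xj.
  by apply/conj_end_edge; eexists.
have Yj : (Y *~ j)%R = attach eps b z.
  by apply: (@is_vgroup_inj _ _ _ S w); rewrite qj is_attach qz.
have [|Z _ YZ] := maximal_cyclic_isolated tubD (primD eps b) j0 (y := Y).
  by rewrite Yj; exists z.
have : bs_stabilizer H (is_erep S eps) (is_egroup S Z).
  by rewrite -is_egroup_range; exists Z.
case=> _ /edge_coset; congr edge_subgroup.
move: qY; rewrite -YZ is_attach -/c /q => /mulIg/mulgI ->.
by rewrite !mulgA mulgK mulgV mul1g.
Qed.

End VirtuallyPrimitive.

(** * The splitting of a congruence subgroup *)

(** The orbits of H on the cosets of B i are double cosets, that is, cosets of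
    the image of B i in the finite quotient by H. They are the vertices and
    edges of the quotient of the Bass-Serre tree by H. *)
Lemma finite_double_cosets (K : groupType) (H : set K) (I : finType) (B :
    I -> set K) :
    normal_subgroup H -> finite_index H -> (forall i, subgroup (B i)) ->
  exists (O : finType) (ind : O -> I) (rep : O -> K) (orb : I -> K -> O),
    [/\ forall o, orb (ind o) (rep o) = o, forall i x, ind (orb i x) = i &
     forall i x y, orb i x = orb i y <->
       exists h b, [/\ H h, B i b & y = h * x * b]].
Proof.
move=> nH fH sB; have [T [c cP]] := finite_index_code fH.
pose code i x := (i, finset (fun t => `[< exists2 b, B i b & c (x * b) = t >])).
have codeP i x y : code i x = code i y <->
    exists h b, [/\ H h, B i b & y = h * x * b].
  split=> [[/setP/(_ (c y))]|[h [b [Hh Bb ->]]]].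
    rewrite !inE; have -> : `[< exists2 b, B i b & c (y * b) = c y >].
      by apply/asboolP; exists 1; [exact: subgroup1|rewrite mulg1].
    move=> /asboolP[b Bb /cP Hxby].
    exists (x * b * ((x * b)^-1 * y) * (x * b)^-1), b; split=> //;
      first exact: nH.2.
    by rewrite mulVKg -[RHS]mulgA mulgVK.
  have cH x' : c (h * x') = c x'.
    apply/esym/cP; rewrite mulgA; have := nH.2 x'^-1 h Hh.
    by rewrite invgK.
  congr pair; apply/setP => t; rewrite !inE;
    apply/asboolP/asboolP => -[b' Bb' <-].
    exists (b^-1 * b'); last by rewrite -!mulgA mulVKg !mulgA -mulgA cH.
    by apply: subgroupM => //; exact: subgroupV.
  by exists (b * b'); [exact: subgroupM|rewrite -!mulgA cH].
pose O := {z : I * {set T} | `[< exists ix, code ix.1 ix.2 = z >]}.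
have ex (o : O) : exists ix, code ix.1 ix.2 = val o by apply/asboolP;
  exact: valP o.
have orbP i x : `[< exists ix, code ix.1 ix.2 = code i x >] by apply/asboolP;
  exists (i, x).
pose rep (o : O) := sval (cid (ex o)).
have repP o : code (rep o).1 (rep o).2 = val o by exact: (svalP (cid (ex o))).
exists O, (fun o => (rep o).1), (fun o => (rep o).2),
  (fun i x => exist _ (code i x) (orbP i x)); split.
- by move=> o; apply: val_inj; rewrite /= repP.
- by move=> i x; have /(congr1 fst) := repP (exist _ (code i x) (orbP i x)).
move=> i x y; rewrite -codeP; split=> [/(congr1 val)//|eq_c].
exact: val_inj.
Qed.

Section CongruenceSplitting.
Variables (G : tubular_group) (P : primitive_model G) (H : set (pi1 G)).
Hypothesis nH : normal_subgroup H.

(** With this condition the stabilizers in H are the groups of the model. *)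
Hypothesis HP : forall v x, H (at_vertex v x) <-> exists y, x = model_to P v y.

Lemma congruence_edge e j :
  H (at_vertex (endpoint e false) (edge_vec e false *~ j)%R) <->
  exists i, j = (model_index P e * i)%R.
Proof.
rewrite HP; split=> [[y aj]|[i ->]]; last first.
  by exists (model_vec P e false *~ i)%R; rewrite raddfMz model_to_vec mulrzA.
have k0 := model_index_neq0 P e.
have [|i [_ ->]] :=
    @unimodular_div (model_vec P e false) y (model_index P e) j
    (model_vecU P e false) k0.
  apply: (@model_to_inj G P (endpoint e false)).
  by rewrite !raddfMz model_to_vec -aj -!mulrzA mulrC.
by exists i; rewrite mulrC.
Qed.

Variables (OV : finType) (vind : OV -> vertex G) (vrep : OV -> pi1 G)
  (vorb : vertex G -> pi1 G -> OV).
Hypotheses (vorbK : forall o, vorb (vind o) (vrep o) = o)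
  (vindE : forall v x, vind (vorb v x) = v)
  (vorbP : forall v x y, vorb v x = vorb v y <->
     exists h b, [/\ H h, vertex_subgroup v b & y = h * x * b]).

Variables (OE : finType) (eind : OE -> edge G) (erep : OE -> pi1 G)
  (eorb : edge G -> pi1 G -> OE).
Hypotheses (eorbK : forall o, eorb (eind o) (erep o) = o)
  (eindE : forall e x, eind (eorb e x) = e)
  (eorbP : forall e x y, eorb e x = eorb e y <->
     exists h b, [/\ H h, edge_subgroup e b & y = h * x * b]).

(** The quotient of the Bass-Serre tree by H. All the groups over a vertex or
    an edge of G are conjugate, as H is normal, so the attaching maps are those
    of the model. *)
Definition congruence_graph : graph_of_groups :=
  @GraphOfGroups OV OE
    (fun o b => vorb (endpoint (eind o) b) (erep o * edge_end (eind o) b))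
    (fun=> vec) (fun=> int)
    (fun o b => multiples (model_vec P (eind o) b)).

Let D := congruence_graph.

Lemma vorb_vertex v x a : vorb v (x * at_vertex v a) = vorb v x.
Proof.
apply/esym/vorbP; exists 1, (at_vertex v a).
split; [exact: subgroup1 nH.1|by apply/vertex_subgroupP;
  exists a|by rewrite mul1g].
Qed.

Lemma vorb_left v h x : H h -> vorb v (h * x) = vorb v x.
Proof.
move=> Hh; apply/esym/vorbP; exists h, 1; split; rewrite ?mulg1 //.
exact: subgroup1 (vertex_subgroup_subgroup v).
Qed.

Lemma congruence_endpoint e x b :
  endpoint (eorb e x : edge D) b = vorb (endpoint e b) (x * edge_end e b).
Proof.
rewrite /= eindE; have := eorbK (eorb e x); rewrite eindE => /esym/eorbP.
case=> h [z [Hh /edge_subgroupP[k ->] ->]].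
have rel : at_vertex (endpoint e false) (edge_vec e false *~ k)%R
    * edge_end e b =
    edge_end e b * at_vertex (endpoint e b) (edge_vec e b *~ k)%R.
  by rewrite -(conj_end_edge_vec e b) /conj_end mulgVK.
by rewrite -(mulgA (h * x)) rel -(mulgA h) [LHS]vorb_left // mulgA vorb_vertex.
Qed.

Definition joined (o o' : vertex D) := exists p, walk o p o'.

Lemma joined_trans o1 o2 o3 : joined o1 o2 -> joined o2 o3 -> joined o1 o3.
Proof. by move=> [p wp] [q wq]; exists (p ++ q); exact: walk_cat wp wq. Qed.

Lemma joined_dart (d : dart G) x :
  joined (vorb (dart_from d) x) (vorb (dart_to d) (x * at_dart d)).
Proof.
have step (o : edge D) b : joined (endpoint o b) (endpoint o (~~ b)).
  by exists [:: (o, ~~ b)]; rewrite /= /dart_from /dart_to /= negbK !eqxx.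
case: d => e []; rewrite /dart_from /dart_to /at_dart /dart_val /=.
  by have := step (eorb e x) false;
    rewrite !congruence_endpoint /edge_end mulg1.
have := step (eorb e (x * (stable_letter e)^-1)) true.
by rewrite !congruence_endpoint /edge_end mulg1 mulgVK.
Qed.

(** The letters of the tree are trivial, so the translates of its vertices by
    x are joined in the quotient. *)
Lemma joined_tree v w x : joined (vorb v x) (vorb w x).
Proof.
have [_ /(_ v w)[p [[walk_p _ Tp] _]]] := treeP G.
elim: p v walk_p Tp => [|d p IH] v /=; first by move=> /eqP-> _; exists [::];
  exact: eqxx.
case/andP=> /eqP <- walk_p /andP[Td Tp]; apply: joined_trans (IH _ walk_p Tp).
have := joined_dart d x; rewrite /at_dart /dart_val stable_letter_tree //.
by rewrite invg1; case: ifP; rewrite mulg1.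
Qed.

Lemma congruence_graph_connected : connected_graph D.
Proof.
have [[[v0 _] _] _ _ _] := splittingP G.
split; first by exists (vorb v0 1).
suff conn (g x : pi1 G) v w : joined (vorb v x) (vorb w (x * g)).
  move=> o o'; have := conn ((vrep o)^-1 * vrep o') (vrep o) (vind o) (vind o').
  by rewrite mulVKg !vorbK.
elim/(@pi1_ind G): g x v w => [|u a g IH|d g IH] x v w.
- by rewrite mulg1; exact: joined_tree.
- apply: joined_trans (joined_tree v u x) _.
  by rewrite mulgA -(vorb_vertex u x a); exact: IH.
apply: joined_trans (joined_tree v (dart_from d) x) _.
by apply: joined_trans (joined_dart d x) _; rewrite mulgA; exact: IH.
Qed.

Lemma congruence_graph_tubular : tubular D.
Proof.
split; first exact: congruence_graph_connected.
- by move=> v; exists (idfun : {additive vec -> vec}); exists id.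
- by move=> e; exists (idfun : {additive int -> int}); exists id.
- by move=> e b; exact/vec_mulz_inj/unimodular_neq0/model_vecU.
Qed.

Lemma congruence_graph_primitive : primitive D.
Proof. by move=> e b; exact/maximal_cyclic_unimodular/model_vecU. Qed.

Lemma orbit_stabilizer (I : Type) (i : I) (B : set (pi1 G)) (x h : pi1 G) :
  subgroup B ->
  bs_stabilizer H (i, ltranslate x B) h <->
    exists b, [/\ H b, B b & h = x * b * x^-1].
Proof.
move=> sB; rewrite /bs_stabilizer /= bs_act_coset; split.
  case=> Hh [/(ltranslate_eq _ _ sB)[b Bb hx]]; exists b; split=> //.
    by apply/(normalJ x b nH); rewrite -hx mulgK.
  by rewrite -hx mulgK.
case=> b [Hb Bb ->]; split; first exact: nH.2.
by congr pair; apply/(ltranslate_eq _ _ sB); exists b; rewrite // mulgVK.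
Qed.

Lemma orbit_classification (I : Type) (O : Type) (ind : O -> I) (rep :
    O -> pi1 G)
    (orb : I -> pi1 G -> O) (B : I -> set (pi1 G)) (p : I * set (pi1 G)) :
    (forall i, subgroup (B i)) -> (forall o, orb (ind o) (rep o) = o) ->
    (forall i x, ind (orb i x) = i) ->
    (forall i x y, orb i x = orb i y <->
      exists h b, [/\ H h, B i b & y = h * x * b]) ->
    (exists g, p.2 = ltranslate g (B p.1)) ->
  exists! o, exists2 h, H h & p =
    bs_act h (ind o, ltranslate (rep o) (B (ind o))).
Proof.
case: p => i C sB orbK indE orbP /= [x ->]; exists (orb i x); split.
  have := orbK (orb i x); rewrite indE => /orbP[h [b [Hh Bb xE]]].
  exists h => //; rewrite bs_act_coset; congr pair.
  by apply/(ltranslate_eq _ _ (sB i)); exists b.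
move=> o [h Hh]; rewrite bs_act_coset => -[def_i xE].
move: xE; rewrite -def_i => /(ltranslate_eq _ _ (sB i))[b Bb ->].
by rewrite -[o in RHS]orbK -def_i; apply/esym/orbP; exists h, b.
Qed.

Lemma congruence_splitting : inhabited (induced_splitting H D).
Proof.
pose Vsub := @vertex_subgroup_subgroup G;
  pose Esub := @edge_subgroup_subgroup G.
have /choice[c cP] (ob : OE * bool) : exists h, H h /\ exists a,
    vrep (endpoint (ob.1 : edge D) ob.2) =
      h * (erep ob.1 * edge_end (eind ob.1) ob.2) *
      at_vertex (endpoint (eind ob.1) ob.2) a.
  have := vorbK (endpoint (ob.1 : edge D) ob.2); rewrite /= vindE => /esym.
  case/vorbP => h [b [Hh /vertex_subgroupP[a ->] repE]].
  by exists h; split=> //; exists a.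
constructor; unshelve refine (@InducedSplitting G H D
  (fun o => (vind o, ltranslate (vrep o) (vertex_subgroup (vind o))))
  (fun o => (eind o, ltranslate (erep o) (edge_subgroup (eind o))))
  (fun o (y : vec) =>
    vrep o * at_vertex (vind o) (model_to P (vind o) y) * (vrep o)^-1)
  (fun o (j : int) => erep o * at_vertex (endpoint (eind o) false)
      (edge_vec (eind o) false *~ (model_index P (eind o) * j))%R * (erep o)^-1)
  (fun o b => c (o, b)) _ _ _ _ _ _ _ _ _ _ _ _ _).
- by move=> o; exists (vrep o).
- by move=> o; exists (erep o).
- by move=> p; exact: orbit_classification.
- by move=> p; exact: orbit_classification.
- by move=> o x y; rewrite raddfD at_vertexD !mulgA mulgVK.
- by move=> o x y /mulIg/mulgI/at_vertex_inj/model_to_inj.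
- move=> o; apply/seteqP; split=> g.
    case=> y _ <-; apply/(orbit_stabilizer _ _ _ (Vsub _)).
    exists (at_vertex (vind o) (model_to P (vind o) y)); split=> //.
      by apply/HP; exists y.
    by apply/vertex_subgroupP; eexists.
  move=> /(orbit_stabilizer _ _ _ (Vsub _))[b [+ /vertex_subgroupP[x bx] ->]].
  by rewrite bx => /HP[y ->]; exists y.
- by move=> o x y; rewrite mulrDr mulrzDr at_vertexD !mulgA mulgVK.
- move=> o x y /mulIg/mulgI/at_vertex_inj/(vec_mulz_inj (edge_vec_neq0 _ _)).
  exact/mulfI/model_index_neq0.
- move=> o; apply/seteqP; split=> g.
    case=> j _ <-; apply/(orbit_stabilizer _ _ _ (Esub _)).
    eexists; split; [|by apply/edge_subgroupP; eexists|reflexivity].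
    by apply/congruence_edge; exists j.
  move=> /(orbit_stabilizer _ _ _ (Esub _))[b [+ /edge_subgroupP[x bx] ->]].
  by rewrite bx => /congruence_edge[j ->]; exists j.
- by move=> o b; have [] := cP (o, b).
- move=> o b; have [_ [a aE]] := cP (o, b).
  rewrite bs_endpoint_coset bs_act_coset /= in aE *; rewrite vindE aE;
    congr pair.
  apply/(ltranslate_eq _ _ (Vsub _));
    exists (at_vertex (endpoint (eind o) b) (- a)%R).
    by apply/vertex_subgroupP; eexists.
  by rewrite at_vertexN mulgK.
move=> o b j; have [_ [a aE]] := cP (o, b).
rewrite /= in aE *; rewrite aE vindE raddfMz model_to_vec -mulrzA.
set z := (edge_vec _ b *~ _)%R; set v := endpoint _ b.
have -> : at_vertex (endpoint (eind o) false)
    (edge_vec (eind o) false *~ (model_index P (eind o) * j))%R =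
    conj_end (eind o) b (at_vertex v z) by rewrite conj_end_edge_vec.
rewrite /conj_end !invgM !mulgA -[_ * _ * at_vertex v z]mulgA at_vertex_comm
  !mulgA mulgK.
by [].
Qed.

End CongruenceSplitting.

(** The kernel of the affine action modulo the exponent of the model. *)
Lemma model_virtually_primitive (G : tubular_group) (P : primitive_model G) :
  virtually_primitive G.
Proof.
have [[[v0 _] _] _ _ _] := splittingP G.
have [F [g [_ Fv _]]] :=
  @reduction_representation G P (model_exp P) v0 [::] 0%R (eqxx v0) isT.
have [nH fH] := kernel_finite_index F; set H := (X in finite_index X) in fH.
have HP v x : H (at_vertex v x) <-> exists y, x = model_to P v y.
  transitivity (reduction P (model_exp P) v x = 0%R).
    rewrite -[H _]/(F (at_vertex v x) = 1) Fv; split=> [|->]; last first.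
      have -> : translation 'I_1 (0 :
          'Z_(model_exp P) * 'Z_(model_exp P))%R = 1.
        by apply: eq_permutation => s; exact: shift0.
      by rewrite mulg1 mulgV.
    move/divg1_eq; rewrite -{2}[g v]mulg1 => /mulgI.
    move/(congr1 (fun s : permutation _ => (s (0%R, ord0)).1)) => /=.
    by rewrite add0r.
  rewrite (reduction_eq0 P (model_exp_gt1 P)); split=> -[y].
    move=> xy; exists y; apply: (@model_from_inj G P v).
    by rewrite model_toK.
  by move=> ->; exists y; rewrite model_toK.
have [OV [vi [vr [vo [voK viE voP]]]]] :=
  finite_double_cosets nH fH (@vertex_subgroup_subgroup G).
have [OE [ei [er [eo [eoK eiE eoP]]]]] :=
  finite_double_cosets nH fH (@edge_subgroup_subgroup G).
exists H; split=> //; exists (congruence_graph P vo ei er); split.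
- exact: (congruence_splitting nH HP voK viE voP eoK eiE eoP).
- exact: (congruence_graph_tubular P nH voK voP eoK eiE eoP).
- exact: congruence_graph_primitive.
Qed.

(** * The equivalences *)

Theorem theorem4p3 (G : tubular_group) :
  [<-> residually_finite (pi1 G);
       has_primitive_domain G;
       has_primitive_target G;
       virtually_primitive G;
       separable_edge_groups G;
       has_regulating_tuple G].
Proof.
have isolable_model : edges_isolable G -> inhabited (primitive_model G).
  by move=> iso; exact/regulating_model/isolable_regulating.
tfae.
- by move=> /residually_finite_isolable/isolable_model[P]; exact: model_domain.
- by move=> /domain_regulating/regulating_model[P]; exact: model_target.
- move=> /target_regulating/regulating_model[P].
  exact: model_virtually_primitive.
- move=> /virtually_primitive_isolable/isolable_model[P].
  exact: model_separable.
- by move=> /separable_isolable/isolable_regulating.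
- by move=> /regulating_model[P]; exact: model_residually_finite.
Qed.
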